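(* Consider the system $x(t+1)=Ax(t)+Bu(t)+w(t)$, $x(0)=0$, with $$A=\begin{bmatrix} A_{11} & 0 \\ A_{21} & A_{22} \end{bmatrix},\quad B=\begin{bmatrix} B_1 & 0 \\ 0 & B_2 \end{bmatrix},\quad x=\begin{bmatrix} x_1 \\ x_2 \end{bmatrix},\quad u=\begin{bmatrix} u_1 \\ u_2 \end{bmatrix},\quad w=\begin{bmatrix} w_1 \\ w_2 \end{bmatrix},$$ where $\{w(t)\}$ is a sequence of mutually independent zero-mean Gaussian vectors with $\mathbf{E}\{w(k)w^T(l)\}=\begin{bmatrix} W_1 & 0 \\ 0 & W_2 \end{bmatrix}\delta(k-l)$. Consider the problem of minimizing the cost $$\lim_{N\to\infty}\frac1N\,\mathbf{E}\sum_{t=0}^{N-1}\left(x^T(t)Qx(t)+u^T(t)Ru(t)\right),$$ with $Q$ positive semidefinite and $R$ positive definite, over all controllers for which, at each time $t$, $u_1(t)$ is a function of $x_1(0:t)$ and $u_2(t)$ is a function of $x(0:t)$ (i.e. of $x_1(0:t)$ and $x_2(0:t)$). Assume that (i) $(A,B)$ is stabilizable, (ii) $(A_{22},B_2)$ is stabilizable, (iii) $(Q,A)$ is detectable, (iv) $(Q_{22},A_{22})$ is detectable. Let $X$ and $Y$ be the positive semidefinite stabilizing solutions to the Riccati equations $$X=A^TXA+Q-A^TXB(B^TXB+R)^{-1}B^TXA,$$ $$Y=A_{22}^TYA_{22}+Q_{22}-A_{22}^TYB_2(B_2^TYB_2+R_{22})^{-1}B_2^TYA_{22},$$ with $X=[X_{ij}]$,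 $i,j=1,2$, partitioned compatibly with $A$, and let $$L^1=(R+B^TXB)^{-1}B^TXA,\qquad L^2=(R_{22}+B_2^TYB_2)^{-1}B_2^TYA_{22},$$ with $L^1=[L_{ij}]$, $i,j=1,2$, partitioned into blocks (rows according to $u_1,u_2$, columns according to $x_1,x_2$). Then the optimal controller is given by $$\eta(t+1)=(A_{22}-B_2L_{22})\eta(t)+\begin{bmatrix} A_{21}-B_2L_{21} & 0 \end{bmatrix}\begin{bmatrix} x_1(t) \\ x_2(t) \end{bmatrix},\qquad \eta(0)=0,$$ $$u(t)=-\begin{bmatrix} L_{12} \\ L_{22}-L^2 \end{bmatrix}\eta(t)-\begin{bmatrix} L_{11} & 0 \\ L_{21} & L^2 \end{bmatrix}\begin{bmatrix} x_1(t) \\ x_2(t) \end{bmatrix},$$ and the optimal cost is $$\mathbf{Tr}(X_{11}W_1)+\mathbf{Tr}(YW_2).$$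
   Context: The superscripts in $L^1,L^2$ are labels, not powers. $x(0:t)$ denotes the sequence $x(0),x(1),\dots,x(t)$, and similarly for $x_1(0:t)$, $x_2(0:t)$. $\mathbf{E}$ is expectation, $\mathbf{Tr}$ is trace, and $\delta(k-l)$ equals $1$ if $k=l$ and $0$ otherwise. $Q=[Q_{ij}]$ and $R=[R_{ij}]$, $i,j=1,2$, are symmetric and partitioned compatibly with $x=(x_1,x_2)$ and $u=(u_1,u_2)$ respectively. Detectability of $(Q,A)$ means detectability of the pair with output matrix $Q$ and state matrix $A$. A solution of a Riccati equation is stabilizing if the corresponding closed-loop matrix ($A-BL^1$ for $X$, $A_{22}-B_2L^2$ for $Y$) has all its eigenvalues in the open unit disc. *)

(* Defs.v *)
From HB Require Import structures.
From mathcomp Require Import all_boot all_order all_algebra.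
From mathcomp Require Import all_classical all_reals all_analysis.
From mathcomp Require Import complex.

Set Implicit Arguments.
Unset Strict Implicit.
Unset Printing Implicit Defensive.

Import Order.TTheory GRing.Theory Num.Theory.
Import numFieldNormedType.Exports.

Local Open Scope classical_set_scope.
Local Open Scope ring_scope.

(* Matrices carry the product sigma-algebra of their entries, i.e. the smallest
   one making every entry measurable; over the reals this is the Borel one. *)
Definition measure_matrix_display : measure_display -> measure_display.
Proof. exact. Qed.

Section measurable_matrix.
Context {d} {T : measurableType d}.
Variables m n : nat.

Definition matrix_cylinders : set (set 'M[T]_(m, n)) :=
  [set C | exists (i : 'I_m) (j : 'I_n), exists2 A : set T,
     measurable A & C = [set M : 'M[T]_(m, n) | A (M i j)]].

Let matrix_set0 : <<s matrix_cylinders >> set0.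
Proof. exact: sigma_algebra0. Qed.

Let matrix_setC A :
  <<s matrix_cylinders >> A -> <<s matrix_cylinders >> (~` A).
Proof. by move=> sA; rewrite -setTD; exact: sigma_algebraCD. Qed.

Let matrix_bigcup (F : (set 'M[T]_(m, n))^nat) :
  (forall i, <<s matrix_cylinders >> (F i)) ->
  <<s matrix_cylinders >> (\bigcup_i (F i)).
Proof. exact: sigma_algebra_bigcup. Qed.

HB.instance Definition _ := @isMeasurable.Build (measure_matrix_display d)
  'M[T]_(m, n) <<s matrix_cylinders >> matrix_set0 matrix_setC matrix_bigcup.

End measurable_matrix.

Section linear_systems.
Context {K : realType}.

Definition psd n (M : 'M[K]_n) :=
  M^T = M /\ forall v : 'cV[K]_n, 0 <= (v^T *m M *m v) 0 0.

Definition posdef n (M : 'M[K]_n) :=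
  M^T = M /\ forall v : 'cV[K]_n, v != 0 -> 0 < (v^T *m M *m v) 0 0.

Definition schur_stable n (M : 'M[K]_n) :=
  forall z : K[i], eigenvalue (map_mx (real_complex K) M) z -> `|z| < 1.

Definition stabilizable n m (A : 'M[K]_n) (B : 'M[K]_(n, m)) :=
  exists F : 'M[K]_(m, n), schur_stable (A - B *m F).

Definition detectable n p (C : 'M[K]_(p, n)) (A : 'M[K]_n) :=
  exists G : 'M[K]_(n, p), schur_stable (A - G *m C).

Definition riccati_gain n m (A : 'M[K]_n) (B : 'M[K]_(n, m)) (R : 'M[K]_m)
    (X : 'M[K]_n) : 'M[K]_(m, n) :=
  invmx (R + B^T *m X *m B) *m B^T *m X *m A.

Definition stabilizing_riccati_solution n m (A : 'M[K]_n) (B : 'M[K]_(n, m))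
    (Q : 'M[K]_n) (R : 'M[K]_m) (X : 'M[K]_n) :=
  [/\ psd X,
      X = A^T *m X *m A + Q
          - A^T *m X *m B *m invmx (B^T *m X *m B + R) *m B^T *m X *m A
    & schur_stable (A - B *m riccati_gain A B R X)].

End linear_systems.

Section gaussian_noise.
Context d (T : measurableType d) (K : realType) (P : probability T K).

(* A constant counts as normal; [normal_prob m 0] is not the Dirac measure,
   whence the first disjunct. *)
Definition gaussian_rv (Y : T -> K) :=
  exists m : K,
    (forall E, measurable E -> P (Y @^-1` E) = \d_m E) \/
    (exists2 s : K, 0 < s &
       forall E, measurable E -> P (Y @^-1` E) = normal_prob m s E).

Definition gaussian_vector n (Y : T -> 'cV[K]_n) :=
  forall a : 'cV[K]_n, gaussian_rv (fun om => (a^T *m Y om) 0 0).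

Definition mutually_independent n (w : nat -> T -> 'cV[K]_n) :=
  forall (s : seq nat) (E : nat -> set 'cV[K]_n), uniq s ->
    (forall t, measurable (E t)) ->
    (P (\bigcap_(t in [set` s]) (w t @^-1` E t)) =
     \prod_(t <- s) P (w t @^-1` E t))%E.

Definition gaussian_white_noise n (W : 'M[K]_n)
    (w : nat -> {RV P >-> 'cV[K]_n}) :=
  [/\ mutually_independent w,
      forall t, gaussian_vector (w t),
      forall t i, ('E_P[(fun om => w t om i 0)%R] = 0)%E
    & forall k l i j,
        ('E_P[(fun om => w k om i 0 * w l om j 0)%R]
         = ((W *+ (k == l)) i j)%:E)%E].

End gaussian_noise.

Section two_player_control.
Context d (T : measurableType d) (K : realType) (P : probability T K).
Context {n1 n2 m1 m2 : nat}.
Implicit Types (x w : nat -> T -> 'cV[K]_(n1 + n2)).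
Implicit Types (u : nat -> T -> 'cV[K]_(m1 + m2)).

Definition system (A : 'M[K]_(n1 + n2)) (B : 'M[K]_(n1 + n2, m1 + m2)) w x u :=
  forall om, x 0%N om = 0 /\
    forall t, x t.+1 om = A *m x t om + B *m u t om + w t om.

(* The feedback laws need not be linear; measurability is what makes the
   expected cost meaningful. *)
Definition information_constraint x u :=
  forall t,
    (exists2 f : t.+1.-tuple 'cV[K]_n1 -> 'cV[K]_m1, measurable_fun setT f &
       forall om, usubmx (u t om) = f [tuple usubmx (x s om) | s < t.+1]) /\
    (exists2 g : t.+1.-tuple 'cV[K]_(n1 + n2) -> 'cV[K]_m2,
       measurable_fun setT g &
       forall om, dsubmx (u t om) = g [tuple x s om | s < t.+1]).

(* The value may be +oo. *)
Definition average_cost (Q : 'M[K]_(n1 + n2)) (R : 'M[K]_(m1 + m2)) x u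
    (N : nat) : \bar K :=
  ((N%:R^-1)%:E *
   'E_P[(fun om => \sum_(t < N) ((x t om)^T *m Q *m x t om
                               + (u t om)^T *m R *m u t om) 0 0)%R])%E.

End two_player_control.

(* Main.v *)
Require Import Defs.
From HB Require Import structures.
From mathcomp Require Import all_boot all_order all_algebra.
From mathcomp Require Import all_classical all_reals all_analysis.
From mathcomp Require Import complex measurable_realfun ring lra.

Set Implicit Arguments.
Unset Strict Implicit.
Unset Printing Implicit Defensive.

Import Order.TTheory GRing.Theory Num.Theory.
Import numFieldNormedType.Exports.

Local Open Scope classical_set_scope.
Local Open Scope ring_scope.

(** Why the theorem is true.

Write a closed-loop state as [x = xh + (0, xt)], where [xh = (x1, eta)] is
what can be reconstructed from the noise of the first subsystem, and
[xt = x2 - eta] is the residual.  In these coordinates the proposed controller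
produces two independent loops,
[xh(t+1) = (A - B L1) xh(t) + (w1(t), 0)] and
[xt(t+1) = (A22 - B2 L2) xt(t) + w2(t)]: the estimate follows the centralized
optimal loop, driven by [w1] only, and the residual follows the optimal loop of
the second subsystem, driven by [w2] only.  They are uncorrelated, so the
Lyapunov form of the two Riccati equations ([riccati_lyapunov]) telescopes the
expected cost of [N] stages into [N J] minus the boundary terms
[E xh(N)^T X xh(N)] and [E xt(N)^T Y xt(N)] ([mean_opt_cost]).  Stability keeps
these bounded, so the average cost tends to [J] ([controller_average_cost]).

For the lower bound, an arbitrary admissible pair [(x, u)] is compared with
the closed loop [(xo, uo)] driven by the same noise.  The deviation
[(dx, du)] obeys the noise-free dynamics, and since the cost is quadratic, the
cost of [(x, u)] is that of [(xo, uo)], plus that of [(dx, du)], plus twice a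
first variation ([cost_expansion]).  With the costate
[p = X xh + (0, Y xt)] the first variation telescopes ([costate_step]) into
[- p(N)^T dx(N)] plus two kinds of terms: products of the noise [w(t)] with
[dx(t+1)], which depends on the noise before time [t] only, and products of
[xt(t)] with the first blocks of [dx(t)] and [du(t)], which by the information
constraint depend on [w1] only.  All these have mean zero
([noise_pairing_mean]).  What is left, [cost(dx, du) - 2 p(N)^T dx(N)], is at
least [- c |p(N)|^2] with [c] independent of [N] and of the controller: by
detectability [|dx(N)|^2 <= c * cost(dx, du)], path by path
([detectable_terminal_bound]).  As [E |p(N)|^2] is bounded, the expected cost
of [N] stages is at least [N J - k] for a constant [k] ([cost_lower_bound]).

That [w2] is orthogonal to every square integrable, possibly nonlinear,
function of the history of [w1] is where normality enters.  The linear forms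
[a . w1 + c w2_j] and [a . w1 - c w2_j] are centred normal variables of equal
variance, hence have the same law; comparing the means of their sines and
letting [c] tend to 0 gives [E [w2_j cos(a . w1 + b)] = 0]
([gaussian_uncorrelated_null]).  A Fourier uniqueness argument then replaces
the cosine by indicators of orthants ([fourier_null_orthant]), a monotone
class argument replaces these by arbitrary functions of [w1(t)]
([orthogonal_sigma_algebra]), and independence in time extends the result to
the whole history ([independent_past_null]). *)

(** * Powers of Schur stable matrices *)
Section summable_powers.
Variables (C : numClosedFieldType) (n : nat).
Implicit Types F M : 'M[C]_n.+1.

Definition summable_powers F M :=
  exists c : C, forall N i j, \sum_(k < N) `|(F ^+ k * M) i j| <= c.

(** One factor [F - z] of the characteristic polynomial can be peeled off: the
recursion [F^(k+1) M = z F^k M + F^k (F - z) M] gives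
[S <= s + |z| S + c] for the partial sums [S]. *)
Lemma summable_powers_root F M z :
  `|z| < 1 -> summable_powers F ((F - z%:M) * M) -> summable_powers F M.
Proof.
move=> z1 [c sumc]; have z1' : 0 < 1 - `|z| by rewrite subr_gt0.
pose s := \sum_i \sum_j `|M i j|.
exists ((s + c) / (1 - `|z|)) => N i j; rewrite ler_pdivlMr//.
set T := \sum_(k < N) _.
have Ms : `|M i j| <= s.
  rewrite /s (bigD1 i)//= (bigD1 j)//= -addrA lerDl addr_ge0 ?sumr_ge0// => k _.
  by rewrite sumr_ge0.
suff : T <= s + `|z| * T + c by rewrite mulrBr mulr1 lerBlDr addrAC (mulrC T).
apply: (@le_trans _ _ (\sum_(k < N.+1) `|(F ^+ k * M) i j|)).
  by rewrite big_ord_recr/= lerDl.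
rewrite big_ord_recl/= expr0 mul1r -addrA lerD// mulr_sumr.
apply: (@le_trans _ _ (\sum_(k < N) (`|z| * `|(F ^+ k * M) i j| +
    `|(F ^+ k * ((F - z%:M) * M)) i j|))); last by rewrite big_split lerD.
apply: ler_sum => k _; rewrite /bump/= add1n exprSr -normrM.
have -> : F ^+ k * F * M = z%:M * (F ^+ k * M) + F ^+ k * ((F - z%:M) * M).
  have cz : z%:M * F ^+ k = F ^+ k * z%:M by rewrite -!mulmxE scalar_mxC.
  by rewrite mulrBl mulrBr [z%:M * (F ^+ k * M)]mulrA cz -!mulrA addrC subrK.
by rewrite -mulmxE mul_scalar_mx 2!mxE ler_normD.
Qed.

Lemma summable_powers_roots F (r : seq C) : (forall z, z \in r -> `|z| < 1) ->
  forall M, summable_powers F ((\prod_(z <- r) (F - z%:M)) * M) ->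
  summable_powers F M.
Proof.
elim: r => [_ M|z r IH rz M]; first by rewrite big_nil mul1r.
rewrite big_cons -mulrA => /(summable_powers_root (rz _ (mem_head _ _))).
by apply: IH => y yr; apply: rz; rewrite inE yr orbT.
Qed.

(** By Cayley-Hamilton the product of all the factors [F - z] is 0, whose
powers are summable; the factors are then removed one at a time. *)
Lemma summable_powers_eigenvalues F :
  (forall z, eigenvalue F z -> `|z| < 1) -> summable_powers F 1.
Proof.
move=> Fz; have [r Er] := closed_field_poly_normal (char_poly F).
apply: (@summable_powers_roots _ r).
  move=> z zr; apply: Fz; rewrite eigenvalue_root_char Er.
  by rewrite (monicP (char_poly_monic F)) scale1r root_prod_XsubC.
suff -> : \prod_(z <- r) (F - z%:M) = 0.
  exists 0 => N i j; rewrite big1// => k _.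
  by rewrite mul0r mulr0 mxE normr0.
have := Cayley_Hamilton F; rewrite Er (monicP (char_poly_monic F)) scale1r.
rewrite rmorph_prod/= => <-; apply: eq_bigr => z _.
by rewrite rmorphB/= horner_mx_X horner_mx_C.
Qed.
End summable_powers.

Section input_to_state.
Context {K : realType}.

Lemma schur_stable_summable n (F : 'M[K]_n) : schur_stable F ->
  exists c : K, forall N i j, \sum_(k < N) `|(F ^+ k) i j| <= c.
Proof.
case: n F => [F _|n F sF]; first by exists 0 => N [].
have [c sumc] := summable_powers_eigenvalues sF.
have c0 : 0 <= c by have := sumc 0%N ord0 ord0; rewrite big_ord0.
exists (complex.Re c) => N i j; rewrite -lecR RRe_real ?ger0_real//.
apply: le_trans (sumc N i j); rewrite raddf_sum; apply: ler_sum => k _.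
by rewrite mulr1 -rmorphXn/= mxE normc_def/= expr0n/= addr0 sqrtr_sqr.
Qed.

Definition sqnorm n (v : 'cV[K]_n) := \sum_i v i 0 ^+ 2.
Definition l1norm n (v : 'cV[K]_n) := \sum_i `|v i 0|.
Definition mxl1norm m n (M : 'M[K]_(m, n)) := \sum_i \sum_j `|M i j|.

Lemma sqnorm_ge0 n (v : 'cV[K]_n) : 0 <= sqnorm v.
Proof. by apply: sumr_ge0 => i _; exact: sqr_ge0. Qed.

Lemma mxl1norm_ge0 m n (M : 'M[K]_(m, n)) : 0 <= mxl1norm M.
Proof. by apply: sumr_ge0 => i _; apply: sumr_ge0. Qed.

Lemma l1norm_ge0 n (v : 'cV[K]_n) : 0 <= l1norm v.
Proof. by apply: sumr_ge0. Qed.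

Lemma l1norm_mul m n (M : 'M[K]_(m, n)) v :
  l1norm (M *m v) <= mxl1norm M * l1norm v.
Proof.
rewrite /mxl1norm mulr_suml; apply: ler_sum => i _; rewrite mxE mulr_suml.
apply: (le_trans (ler_norm_sum _ _ _)); apply: ler_sum => j _.
rewrite normrM ler_wpM2l// /l1norm (bigD1 j)//= lerDl.
by apply: sumr_ge0.
Qed.

Lemma weighted_cauchy_schwarz N (a b : 'I_N -> K) :
  (forall i, 0 <= a i) -> (forall i, 0 <= b i) ->
  (\sum_i a i * b i) ^+ 2 <= (\sum_i a i) * \sum_i a i * b i ^+ 2.
Proof.
move=> a0 b0; rewrite expr2 !mulr_suml -subr_ge0 -sumrB.
under eq_bigr do rewrite !mulr_sumr -sumrB.
set S := \sum_i _; suff : 0 <= S + S by rewrite -mulr2n pmulrn_lge0.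
rewrite /S [X in _ + X]exchange_big/= -big_split/=.
apply: sumr_ge0 => i _; rewrite -big_split/=; apply: sumr_ge0 => j _.
rewrite (_ : _ + _ = a i * a j * (b i - b j) ^+ 2); last by ring.
by rewrite mulr_ge0 ?sqr_ge0// mulr_ge0.
Qed.

Lemma l1norm_sqr n (v : 'cV[K]_n) : l1norm v ^+ 2 <= n%:R * sqnorm v.
Proof.
have := @weighted_cauchy_schwarz n (fun=> 1) (fun i => `|v i 0|).
rewrite sumr_const card_ord.
under eq_bigr do rewrite mul1r.
under [in X in _ * X]eq_bigr do rewrite mul1r real_normK ?num_real//.
by apply => // i; rewrite normr_ge0.
Qed.

Lemma sqnorm_le_l1norm n (v : 'cV[K]_n) : sqnorm v <= l1norm v ^+ 2.
Proof.
rewrite expr2 /l1norm mulr_suml; apply: ler_sum => i _.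
rewrite -real_normK ?num_real// expr2 ler_wpM2l// (bigD1 i)//= lerDl.
by apply: sumr_ge0.
Qed.

Lemma sqnorm_mul m n (M : 'M[K]_(m, n)) v :
  sqnorm (M *m v) <= (mxl1norm M ^+ 2 * n%:R) * sqnorm v.
Proof.
apply: (le_trans (sqnorm_le_l1norm _)).
apply: (@le_trans _ _ ((mxl1norm M * l1norm v) ^+ 2)).
  by rewrite lerXn2r ?nnegrE ?l1norm_ge0 ?mulr_ge0 ?l1norm_ge0 ?mxl1norm_ge0
             ?l1norm_mul.
by rewrite exprMn -mulrA ler_wpM2l ?sqr_ge0 ?l1norm_sqr.
Qed.

Lemma sqnormD n (v w : 'cV[K]_n) : sqnorm (v + w) <= 2 * (sqnorm v + sqnorm w).
Proof.
rewrite /sqnorm -big_split mulr_sumr; apply: ler_sum => i _; rewrite !mxE/=.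
by rewrite -subr_ge0 (_ : _ - _ = (v i 0 - w i 0) ^+ 2) ?sqr_ge0//; ring.
Qed.

Lemma linear_recursion n (F : 'M[K]_n) (z f : nat -> 'cV[K]_n) :
  z 0%N = 0 -> (forall t, z t.+1 = F *m z t + f t) ->
  forall N, z N = \sum_(s < N) F ^+ (N.-1 - s) *m f s.
Proof.
move=> z0 zS; elim => [|N IH]; first by rewrite big_ord0.
rewrite zS IH big_ord_recr/= subnn expr0 mul1mx mulmx_sumr; congr (_ + _).
apply: eq_bigr => s _; rewrite mulmxA; congr (_ *m _).
rewrite mulmxE -exprS; congr (_ ^+ _).
by case: N s {IH} => [[]//|N s] /=; rewrite subSn// -ltnS.
Qed.

(** The weights [g] do not depend on the input, so this serves both path by
path, with square summable inputs, and in the mean, with inputs of bounded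
variance.  It is Cauchy-Schwarz for the kernel [F^(N-1-s)]. *)
Lemma schur_stable_input_to_state n (F : 'M[K]_n) : schur_stable F ->
  exists c : K, exists2 g : nat -> K,
    (forall k, 0 <= g k) /\ (forall N, \sum_(k < N) g k <= c) &
    forall z f : nat -> 'cV[K]_n,
      z 0%N = 0 -> (forall t, z t.+1 = F *m z t + f t) ->
      forall N, sqnorm (z N) <= \sum_(s < N) g (N.-1 - s)%N * sqnorm (f s).
Proof.
move=> /schur_stable_summable[c sumc].
pose c' := `|\sum_(i < n) \sum_(j < n) c|.
pose a k := mxl1norm (F ^+ k).
have sa N : \sum_(k < N) a k <= c'.
  rewrite exchange_big/= (le_trans _ (ler_norm _))//; apply: ler_sum => i _.
  by rewrite exchange_big; apply: ler_sum => j _; exact: sumc.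
have a0 k : 0 <= a k by exact: mxl1norm_ge0.
have c0 : 0 <= c' * n%:R by rewrite mulr_ge0 ?normr_ge0.
exists (c' * n%:R * c'), (fun k => c' * n%:R * a k).
  split=> [k|N]; first by rewrite mulr_ge0.
  by rewrite -mulr_sumr ler_wpM2l.
move=> z f z0 zS N; rewrite (linear_recursion z0 zS).
apply: (le_trans (sqnorm_le_l1norm _)).
apply: (@le_trans _ _ ((\sum_(s < N) a (N.-1 - s)%N * l1norm (f s)) ^+ 2)).
  rewrite lerXn2r ?nnegrE ?l1norm_ge0//.
    by apply: sumr_ge0 => s _; rewrite mulr_ge0 ?l1norm_ge0.
  apply: (@le_trans _ _ (\sum_(s < N) l1norm (F ^+ (N.-1 - s) *m f s))).
    rewrite exchange_big; apply: ler_sum => i _ /=.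
    by rewrite summxE; apply: ler_norm_sum.
  by apply: ler_sum => s _; exact: l1norm_mul.
apply: (le_trans (weighted_cauchy_schwarz _ _)) => // [s|].
  exact: l1norm_ge0.
have -> : \sum_(s < N) a (N.-1 - s)%N = \sum_(s < N) a s.
  case: N => [|N]; first by rewrite !big_ord0.
  by rewrite (reindex_inj rev_ord_inj); apply: eq_bigr => s _ /=; rewrite subSS subKn// -ltnS.
under [X in _ <= X]eq_bigr do rewrite -mulrA -mulrA.
rewrite -mulr_sumr ler_pM ?sumr_ge0// => [s _|].
  by rewrite mulr_ge0 ?sqr_ge0.
apply: ler_sum => s _.
by rewrite -[leRHS]mulrA [leRHS]mulrCA ler_wpM2l ?l1norm_sqr.
Qed.
End input_to_state.

(** * Quadratic forms and Riccati equations *)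
Section quadratic_forms.
Context {K : realType}.

Definition dot n (u v : 'cV[K]_n) : K := (u^T *m v) 0 0.

Lemma dotE n (u v : 'cV[K]_n) : dot u v = \sum_i u i 0 * v i 0.
Proof. by rewrite /dot mxE; under eq_bigr do rewrite mxE. Qed.

Lemma dotC n (u v : 'cV[K]_n) : dot u v = dot v u.
Proof. by rewrite !dotE; apply: eq_bigr => i _; rewrite mulrC. Qed.

Lemma dotDl n (u v w : 'cV[K]_n) : dot (u + v) w = dot u w + dot v w.
Proof. by rewrite /dot linearD mulmxDl mxE. Qed.

Lemma dotDr n (u v w : 'cV[K]_n) : dot w (u + v) = dot w u + dot w v.
Proof. by rewrite /dot mulmxDr mxE. Qed.

Lemma dotNl n (u v : 'cV[K]_n) : dot (- u) v = - dot u v.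
Proof. by rewrite /dot linearN mulNmx mxE. Qed.

Lemma dotNr n (u v : 'cV[K]_n) : dot u (- v) = - dot u v.
Proof. by rewrite /dot mulmxN mxE. Qed.

Lemma dotZl n a (u v : 'cV[K]_n) : dot (a *: u) v = a * dot u v.
Proof. by rewrite /dot linearZ/= -scalemxAl mxE. Qed.

Lemma dotZr n a (u v : 'cV[K]_n) : dot u (a *: v) = a * dot u v.
Proof. by rewrite /dot -scalemxAr mxE. Qed.

Lemma dot0l n (v : 'cV[K]_n) : dot 0 v = 0.
Proof. by rewrite /dot trmx0 mul0mx mxE. Qed.

Lemma dot0r n (v : 'cV[K]_n) : dot v 0 = 0.
Proof. by rewrite /dot mulmx0 mxE. Qed.

Lemma dotMr m n (M : 'M[K]_(m, n)) u v : dot u (M *m v) = dot (M^T *m u) v.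
Proof. by rewrite /dot trmx_mul trmxK mulmxA. Qed.

Lemma dot_sym n (M : 'M[K]_n) u v : M^T = M -> dot u (M *m v) = dot (M *m u) v.
Proof. by move=> sM; rewrite dotMr sM. Qed.

Lemma dot_col_mx m n (u1 v1 : 'cV[K]_m) (u2 v2 : 'cV[K]_n) :
  dot (col_mx u1 u2) (col_mx v1 v2) = dot u1 v1 + dot u2 v2.
Proof. by rewrite /dot tr_col_mx mul_row_col mxE. Qed.

Lemma quadE n (M : 'M[K]_n) v : (v^T *m M *m v) 0 0 = dot v (M *m v).
Proof. by rewrite /dot mulmxA. Qed.

Lemma dotvv n (v : 'cV[K]_n) : dot v v = sqnorm v.
Proof. by rewrite dotE; apply: eq_bigr => i _; rewrite expr2. Qed.

Lemma quadD n (M : 'M[K]_n) v w : M^T = M ->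
  dot (v + w) (M *m (v + w)) =
  dot v (M *m v) + dot w (M *m w) + 2 * dot (M *m v) w.
Proof.
move=> sM; rewrite mulmxDr !dotDl !dotDr (dot_sym v w sM) (dotC w (M *m v)).
by ring.
Qed.

Lemma psd_sym n (M : 'M[K]_n) : psd M -> M^T = M. Proof. by case. Qed.

Lemma psd_ge0 n (M : 'M[K]_n) v : psd M -> 0 <= dot v (M *m v).
Proof. by case=> _ /(_ v); rewrite quadE. Qed.

Lemma posdef_sym n (M : 'M[K]_n) : posdef M -> M^T = M. Proof. by case. Qed.

Lemma posdef_psd n (M : 'M[K]_n) : posdef M -> psd M.
Proof.
case=> sM pM; split=> // v; have [->|/pM/ltW//] := eqVneq v 0.
by rewrite mulmx0 mxE.
Qed.

Lemma psd_cauchy_schwarz n (M : 'M[K]_n) u v : psd M ->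
  dot u (M *m v) ^+ 2 <= dot u (M *m u) * dot v (M *m v).
Proof.
move=> pM; set a := dot u (M *m u); set b := dot u _; set c := dot v _.
have quad s t : 0 <= s ^+ 2 * a + 2 * (s * t) * b + t ^+ 2 * c.
  have := psd_ge0 (s *: u + t *: v) pM.
  rewrite quadD ?(psd_sym pM)// -!scalemxAr !dotZl !dotZr.
  rewrite -(dot_sym _ _ (psd_sym pM)) -/a -/b -/c => /le_trans; apply.
  by rewrite le_eqVlt; apply/orP; left; apply/eqP; ring.
have c0 : 0 <= c by exact: psd_ge0.
have [c_eq0|c_neq0] := eqVneq c 0.
  rewrite c_eq0 mulr0; have [->|b0] := eqVneq b 0; first by rewrite expr0n.
  have a0 : 0 <= a by exact: psd_ge0.
  (* if the form vanishes at [v], a large multiple of [v] makes it negative *)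
  have := quad 1 (- (a + 1) / b); rewrite c_eq0 mulr0 addr0 expr1n !mul1r.
  rewrite mulrCA mulrA mulfVK// => q0; have : a < 0 by lra.
  by rewrite ltNge a0.
have := quad c (- b); have c_gt0 : 0 < c by rewrite lt0r c_neq0.
rewrite (_ : _ + _ = c * (a * c - b ^+ 2)); last by ring.
by rewrite pmulr_rge0// subr_ge0.
Qed.

(** Cauchy-Schwarz against the basis vectors; the constant is the trace. *)
Lemma psd_sqnorm n (M : 'M[K]_n) : psd M ->
  exists2 c : K, 0 <= c & forall v, sqnorm (M *m v) <= c * dot v (M *m v).
Proof.
move=> pM; pose e (i : 'I_n) : 'cV[K]_n := delta_mx i 0.
exists (\sum_i dot (e i) (M *m e i)); first by apply: sumr_ge0 => i _; exact: psd_ge0.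
move=> v; rewrite mulr_suml; apply: ler_sum => i _ /=.
suff -> : (M *m v) i 0 = dot (e i) (M *m v) by exact: psd_cauchy_schwarz.
by rewrite /dot trmx_delta -rowE [RHS]mxE.
Qed.

Lemma posdef_unit n (M : 'M[K]_n) : posdef M -> M \in unitmx.
Proof.
case=> sM pM; rewrite -row_free_unit -kermx_eq0; apply/eqP/row_matrixP => i.
rewrite row0; apply/eqP; apply: contraT => ri0.
have := pM (row i (kermx M))^T; rewrite -trmx0 (inj_eq trmx_inj) => /(_ ri0).
by rewrite trmxK -row_mul mulmx_ker row0 mul0mx mxE ltxx.
Qed.

Lemma posdef_sqnorm n (M : 'M[K]_n) : posdef M ->
  exists2 c : K, 0 <= c & forall v, sqnorm v <= c * dot v (M *m v).
Proof.
move=> pM; have [c c0 Mc] := psd_sqnorm (posdef_psd pM).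
exists (mxl1norm (invmx M) ^+ 2 * n%:R * c).
  exact: mulr_ge0 (mulr_ge0 (sqr_ge0 _) (ler0n _ _)) c0.
move=> v; rewrite -{1}(mulKmx (posdef_unit pM) v) (le_trans (sqnorm_mul _ _))//.
rewrite -[leRHS]mulrA ler_wpM2l ?Mc//; exact: mulr_ge0 (sqr_ge0 _) (ler0n _ _).
Qed.

End quadratic_forms.

Section riccati.
Context {K : realType} {n m : nat}.
Variables (A : 'M[K]_n) (B : 'M[K]_(n, m)) (Q : 'M[K]_n) (R : 'M[K]_m).
Variable X : 'M[K]_n.
Let L := riccati_gain A B R X.
Hypothesis posR : posdef R.
Hypothesis solX : stabilizing_riccati_solution A B Q R X.

Lemma riccati_unit : R + B^T *m X *m B \in unitmx.
Proof.
have [pX _ _] := solX; apply: posdef_unit; split.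
  by rewrite linearD/= !trmx_mul trmxK (psd_sym pX) (posdef_sym posR) mulmxA.
move=> v v0; rewrite mulmxDr mulmxDl mxE ltr_wpDr//; last by case: posR => _; exact.
rewrite !mulmxA -[v^T *m B^T]trmx_mul -mulmxA.
by case: pX => _; exact.
Qed.

(** With [riccati_costate_eq], this says that [p = X x] is the costate of the
closed loop [u = - L x]: [p(t) = A^T p(t+1) + Q x(t)] and
[B^T p(t+1) + R u(t) = 0]. *)
Lemma riccati_gain_eq : B^T *m X *m (A - B *m L) = R *m L.
Proof.
rewrite mulmxBr; apply/eqP; rewrite subr_eq [X in _ + X]mulmxA -mulmxDl.
by rewrite /L /riccati_gain -!mulmxA mulKVmx ?mulmxA// riccati_unit.
Qed.

Lemma riccati_costate_eq : X = A^T *m X *m (A - B *m L) + Q.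
Proof.
have [_ EX _] := solX; rewrite [LHS]EX.
rewrite mulmxBr [RHS]addrAC; congr (_ - _).
by rewrite /L /riccati_gain [_ + R]addrC !mulmxA.
Qed.

Lemma riccati_lyapunov z :
  dot z (Q *m z) + dot (L *m z) (R *m (L *m z)) =
  dot z (X *m z) - dot ((A - B *m L) *m z) (X *m ((A - B *m L) *m z)).
Proof.
set F := A - B *m L.
have EL : dot (L *m z) (R *m (L *m z)) = dot (B *m L *m z) (X *m (F *m z)).
  by rewrite [R *m _]mulmxA -riccati_gain_eq -!mulmxA dotMr trmxK.
have EQ : dot z (Q *m z) = dot z (X *m z) - dot (A *m z) (X *m (F *m z)).
  rewrite {1}riccati_costate_eq -/F mulmxDl dotDr -!mulmxA (dotMr A^T) trmxK.
  by ring.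
by rewrite EL EQ {3}/F mulmxBl dotDl dotNl; ring.
Qed.

End riccati.

Section detectability.
Context {K : realType} {n m : nat}.
Variables (A : 'M[K]_n) (B : 'M[K]_(n, m)) (Q : 'M[K]_n) (R : 'M[K]_m).

Definition stage_cost (x : 'cV[K]_n) (u : 'cV[K]_m) :=
  dot x (Q *m x) + dot u (R *m u).

Lemma stage_costE x u :
  (x^T *m Q *m x + u^T *m R *m u) 0 0 = stage_cost x u.
Proof. by rewrite mxE !quadE. Qed.

Lemma stage_costD x u dx du : Q^T = Q -> R^T = R ->
  stage_cost (x + dx) (u + du) = stage_cost x u + stage_cost dx du
    + 2 * (dot (Q *m x) dx + dot (R *m u) du).
Proof. by move=> sQ sR; rewrite /stage_cost !quadD//; ring. Qed.

Lemma stage_cost_ge0 x u : psd Q -> psd R -> 0 <= stage_cost x u.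
Proof. by move=> pQ pR; rewrite addr_ge0 ?psd_ge0. Qed.

(** With [A - G Q] stable, the state is the response of a stable system to
the input [G Q x + B u], whose square is dominated by the stage cost: [Q x] is
controlled by [x^T Q x] because [Q] is positive semidefinite, and [u] by
[u^T R u] because [R] is positive definite. *)
Lemma detectable_terminal_bound : psd Q -> posdef R -> detectable Q A ->
  exists2 c : K, 0 < c & forall (x : nat -> 'cV[K]_n) (u : nat -> 'cV[K]_m),
    x 0%N = 0 -> (forall t, x t.+1 = A *m x t + B *m u t) ->
    forall N, sqnorm (x N) <= c * \sum_(t < N) stage_cost (x t) (u t).
Proof.
move=> pQ pR [G /schur_stable_input_to_state[cg [g [g0 sg] gbound]]].
have [cQ cQ0 Qbound] := psd_sqnorm pQ.
have [cR cR0 Rbound] := posdef_sqnorm pR.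
pose a := mxl1norm G ^+ 2 * n%:R * cQ; pose b := mxl1norm B ^+ 2 * m%:R * cR.
have a0 : 0 <= a by exact: mulr_ge0 (mulr_ge0 (sqr_ge0 _) (ler0n _ _)) cQ0.
have b0 : 0 <= b by exact: mulr_ge0 (mulr_ge0 (sqr_ge0 _) (ler0n _ _)) cR0.
have cg0 : 0 <= cg by have := sg 0%N; rewrite big_ord0.
have gcg k : g k <= cg.
  by apply: le_trans (sg k.+1); rewrite big_ord_recr/= lerDr sumr_ge0.
have c0 : 0 <= cg * (2 * (a + b)) by rewrite !mulr_ge0 ?addr_ge0.
(* the added 1 keeps the constant positive *)
exists (cg * (2 * (a + b)) + 1); first by rewrite ltr_pwDr.
move=> x u x0 xS N.
apply: (@le_trans _ _ (cg * (2 * (a + b)) * \sum_(t < N) stage_cost (x t) (u t))).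
  2: by rewrite ler_wpM2r ?lerDl// sumr_ge0// => t _;
       exact/stage_cost_ge0/posdef_psd.
pose f t := G *m (Q *m x t) + B *m u t.
have xSf t : x t.+1 = (A - G *m Q) *m x t + f t.
  by rewrite xS mulmxBl addrA mulmxA subrK.
apply: (le_trans (gbound x f x0 xSf N)).
rewrite mulr_sumr; apply: ler_sum => t _; rewrite -mulrA ler_pM ?sqnorm_ge0//.
apply: (le_trans (sqnormD _ _)); rewrite -mulrA ler_wpM2l//.
have Q0 : 0 <= dot (x t) (Q *m x t) by exact: psd_ge0.
have R0 : 0 <= dot (u t) (R *m u t) by exact/psd_ge0/posdef_psd.
have Gb : sqnorm (G *m (Q *m x t)) <= a * dot (x t) (Q *m x t).
  apply: (le_trans (sqnorm_mul _ _)); rewrite /a -[leRHS]mulrA ler_wpM2l//.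
  exact: mulr_ge0 (sqr_ge0 _) (ler0n _ _).
have Bb : sqnorm (B *m u t) <= b * dot (u t) (R *m u t).
  apply: (le_trans (sqnorm_mul _ _)); rewrite /b -[leRHS]mulrA ler_wpM2l//.
  exact: mulr_ge0 (sqr_ge0 _) (ler0n _ _).
by rewrite /stage_cost; nra.
Qed.

(** This is [|v - c p|^2 >= 0], divided by [c]. *)
Lemma dot_young c (p v : 'cV[K]_n) : 0 < c ->
  - (c * sqnorm p) <= c^-1 * sqnorm v - 2 * dot p v.
Proof.
move=> c0; have := sqnorm_ge0 (v - c *: p).
rewrite -dotvv !(dotDl, dotDr, dotNl, dotNr, dotZl, dotZr) !dotvv (dotC v p).
move=> h; rewrite -(ler_pM2l c0) mulrBr mulrA divff ?gt_eqF//.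
by rewrite -subr_ge0; apply: le_trans h _; rewrite le_eqVlt; apply/orP; left; apply/eqP; ring.
Qed.

End detectability.

Lemma mul_block_col0 (K : realType) p1 p2 q1 q2 (M11 : 'M[K]_(p1, q1))
    (M12 : 'M[K]_(p1, q2)) (M21 : 'M[K]_(p2, q1)) (M22 : 'M[K]_(p2, q2))
    (v : 'cV[K]_q2) :
  block_mx M11 M12 M21 M22 *m col_mx 0 v = col_mx (M12 *m v) (M22 *m v).
Proof. by rewrite mul_block_col !mulmx0 !add0r. Qed.

(** * Pathwise algebra of the two-player problem *)
Section two_player_algebra.
Context {K : realType} {n1 n2 m1 m2 : nat}.
Variables (A11 : 'M[K]_n1) (A21 : 'M[K]_(n2, n1)) (A22 : 'M[K]_n2).
Variables (B1 : 'M[K]_(n1, m1)) (B2 : 'M[K]_(n2, m2)).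
Variables (Q : 'M[K]_(n1 + n2)) (R : 'M[K]_(m1 + m2)).
Variables (X : 'M[K]_(n1 + n2)) (Y : 'M[K]_n2).

Let A : 'M[K]_(n1 + n2) := block_mx A11 0 A21 A22.
Let B : 'M[K]_(n1 + n2, m1 + m2) := block_mx B1 0 0 B2.
Let Q22 := drsubmx Q.
Let R22 := drsubmx R.
Let L1 := riccati_gain A B R X.
Let L2 := riccati_gain A22 B2 R22 Y.
Let F1 := A - B *m L1.
Let F2 := A22 - B2 *m L2.

Hypothesis psdQ : psd Q.
Hypothesis posR : posdef R.
Hypothesis solX : stabilizing_riccati_solution A B Q R X.
Hypothesis solY : stabilizing_riccati_solution A22 B2 Q22 R22 Y.

Lemma posdef_drsubmx : posdef R22.
Proof.
case: posR => sR pR; split; first by rewrite /R22 trmx_drsub sR.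
move=> v v0; have := pR (col_mx 0 v).
rewrite col_mx_eq0 negb_and v0 orbT => /(_ isT).
rewrite -{1}[R]submxK tr_col_mx mul_row_block mul_row_col.
by rewrite trmx0 !mul0mx mulmx0 !add0r.
Qed.

Definition opt_state (xh : 'cV[K]_(n1 + n2)) (xt : 'cV[K]_n2) :=
  xh + col_mx 0 xt.
Definition opt_input xh xt : 'cV[K]_(m1 + m2) :=
  - (L1 *m xh) - col_mx 0 (L2 *m xt).
Definition costate (xh : 'cV[K]_(n1 + n2)) xt := X *m xh + col_mx 0 (Y *m xt).

(** The coefficients left over when [(0, Y xt)] is used as costate of the
residual loop inside the full system.  They pair the residual with the first
blocks of state and input only, and vanish in the mean. *)
Definition cross_state := ursubmx Q + A21^T *m Y *m F2.
Definition cross_input := - (ursubmx R *m L2).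

Lemma opt_system xh xt :
  A *m opt_state xh xt + B *m opt_input xh xt = opt_state (F1 *m xh) (F2 *m xt).
Proof.
rewrite /opt_state /opt_input mulmxBr mulmxDr mulmxN !mul_block_col0 !mul0mx.
rewrite addrACA opp_col_mx add_col_mx oppr0 addr0 mulmxA -mulmxBl -/F1.
by rewrite mulmxA -mulmxBl.
Qed.

(** The first variation of the stage cost in the direction [(dx, du)] is a
difference of consecutive values of the pairing with the costate, up to terms
that only involve the first blocks of [dx] and [du].  The Riccati equation for
[X] cancels everything coming from [xh], and the one for [Y] cancels the second
blocks of what comes from [xt]. *)
Lemma costate_step xh xt dx du :
  dot (Q *m opt_state xh xt) dx + dot (R *m opt_input xh xt) du =
  dot (costate xh xt) dx
  - dot (costate (F1 *m xh) (F2 *m xt)) (A *m dx + B *m du)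
  + (dot (cross_state *m xt) (usubmx dx) + dot (cross_input *m xt) (usubmx du)).
Proof.
have EQ : Q *m opt_state xh xt = costate xh xt - A^T *m costate (F1 *m xh) (F2 *m xt)
    + col_mx (cross_state *m xt) 0.
  have EQ1 : Q *m xh = X *m xh - A^T *m (X *m (F1 *m xh)).
    rewrite [X in X *m xh - _](riccati_costate_eq solX) -/L1 -/F1 mulmxDl.
    by rewrite -!mulmxA addrC addKr.
  have EQ2 : Q *m col_mx 0 xt = col_mx 0 (Y *m xt)
      - A^T *m col_mx 0 (Y *m (F2 *m xt)) + col_mx (cross_state *m xt) 0.
    rewrite -{1}[Q]submxK mul_block_col0 tr_block_mx mul_block_col0.
    rewrite opp_col_mx !add_col_mx add0r addr0.
    rewrite [X in X *m xt - _](riccati_costate_eq solY) -/L2 -/F2 -/Q22.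
    rewrite /cross_state; move: F2 => F; rewrite !mulmxDl -!mulmxA.
    by congr col_mx; [rewrite addrC addrK|rewrite addrC addKr].
  by rewrite /opt_state /costate !mulmxDr EQ1 EQ2 addrA addrACA -opprD.
have ER : R *m opt_input xh xt = - (B^T *m costate (F1 *m xh) (F2 *m xt))
    + col_mx (cross_input *m xt) 0.
  have EL1 : R *m (L1 *m xh) = B^T *m (X *m (F1 *m xh)).
    by rewrite 2![RHS]mulmxA (riccati_gain_eq posR solX) -/L1 [LHS]mulmxA.
  have EL2 : R22 *m (L2 *m xt) = B2^T *m (Y *m (F2 *m xt)).
    by rewrite 2![RHS]mulmxA (riccati_gain_eq posdef_drsubmx solY) -/L2 [LHS]mulmxA.
  rewrite /opt_input /costate mulmxBr mulmxN mulmxDr EL1 opprD -addrA.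
  congr (_ + _); rewrite -{1}[R]submxK mul_block_col0 tr_block_mx mul_block_col0.
  rewrite -/R22 EL2 !trmx0 !mul0mx !opp_col_mx add_col_mx oppr0 add0r addr0.
  by rewrite /cross_input mulNmx mulmxA.
rewrite EQ ER; move: (costate _ _) (costate _ _) => c c'.
rewrite !dotDl !dotNl !dotDr (dotMr A) (dotMr B).
have dot_top k l (a : 'cV[K]_k) (v : 'cV[K]_(k + l)) :
    dot (col_mx a 0) v = dot a (usubmx v).
  by rewrite -{1}[v]vsubmxK dot_col_mx dot0l addr0.
by rewrite !dot_top; ring.
Qed.

Lemma opt_stage_cost xh xt :
  stage_cost Q R (opt_state xh xt) (opt_input xh xt) =
  dot xh (X *m xh) - dot (F1 *m xh) (X *m (F1 *m xh))
  + (dot xt (Y *m xt) - dot (F2 *m xt) (Y *m (F2 *m xt)))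
  + 2 * (dot (Q *m xh) (col_mx 0 xt) + dot (R *m (L1 *m xh)) (col_mx 0 (L2 *m xt))).
Proof.
rewrite -(riccati_lyapunov posR solX) -(riccati_lyapunov posdef_drsubmx solY).
rewrite /opt_state /opt_input -opprD /stage_cost.
rewrite mulmxN dotNl dotNr opprK !quadD; [|exact: posdef_sym|exact: psd_sym].
have quad_col p q (M : 'M[K]_(p + q)) v :
    dot (col_mx 0 v) (M *m col_mx 0 v) = dot v (drsubmx M *m v).
  by rewrite -{1}[M]submxK mul_block_col0 dot_col_mx dot0l add0r.
by rewrite !quad_col -/L1 -/L2 -/Q22 -/R22; ring.
Qed.

End two_player_algebra.

(** * Means and square integrable random variables *)
Section integrals.
Import HBNNSimple.
Context d (T : measurableType d) (K : realType) (P : probability T K).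
Implicit Types f g V : T -> K.

Definition intble f := P.-integrable setT (EFin \o f).
Definition mean f : K := \int[P]_x f x.

Definition sqintble f := measurable_fun setT f /\ intble (fun x => f x ^+ 2).

Lemma intble_measurable f : intble f -> measurable_fun setT f.
Proof. by move=> /measurable_int/measurable_EFinP. Qed.

Lemma intble_le f g : measurable_fun setT f -> (forall x, `|f x| <= g x) ->
  intble g -> intble f.
Proof.
move=> mf fg; apply: le_integrable => //; first exact/measurable_EFinP.
by move=> x _ /=; rewrite lee_fin (le_trans (fg x)) ?ler_norm.
Qed.

Lemma intbleD f g : intble f -> intble g -> intble (fun x => f x + g x).
Proof. by move=> fi gi; exact: (integrableD measurableT fi gi). Qed.

Lemma intbleZ a f : intble f -> intble (fun x => a * f x).
Proof. by move=> fi; exact: (integrableZl measurableT a fi). Qed.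

Lemma intbleB f g : intble f -> intble g -> intble (fun x => f x - g x).
Proof. by move=> fi gi; exact: (integrableB measurableT fi gi). Qed.

Lemma intble_norm f : intble f -> intble (fun x => `|f x|).
Proof. by move=> fi; exact: (integrable_abse fi). Qed.

Lemma intble_cst c : intble (fun=> c).
Proof.
apply: measurable_bounded_integrable => //.
  exact: (le_lt_trans (probability_le1 _ measurableT) (ltry _)).
by exists `|c|; split; rewrite ?num_real// => y /ltW cy x _ /=.
Qed.

Lemma intble_sum (I : Type) (r : seq I) (p : pred I) (f : I -> T -> K) :
  (forall i, p i -> intble (f i)) -> intble (fun x => \sum_(i <- r | p i) f i x).
Proof.
move=> fi; rewrite /intble; have := integrable_sum (mu := P) measurableT r fi.
by apply: eq_integrable => // x _ /=; rewrite sumEFin.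
Qed.

Lemma intbleMbounded f g c : intble f -> measurable_fun setT g ->
  (forall x, `|g x| <= c) -> intble (fun x => f x * g x).
Proof.
move=> fi mg gc; have := intbleZ c (intble_norm fi); apply: intble_le.
  exact: measurable_funM (intble_measurable fi) mg.
by move=> x; rewrite normrM mulrC ler_wpM2r.
Qed.

Lemma meanD f g : intble f -> intble g ->
  mean (fun x => f x + g x) = mean f + mean g.
Proof. by move=> fi gi; exact: (RintegralD measurableT fi gi). Qed.

Lemma meanB f g : intble f -> intble g ->
  mean (fun x => f x - g x) = mean f - mean g.
Proof. by move=> fi gi; exact: (RintegralB measurableT fi gi). Qed.

Lemma meanZ a f : intble f -> mean (fun x => a * f x) = a * mean f.
Proof. by move=> fi; exact: RintegralZl. Qed.

Lemma mean_cst c : mean (fun=> c) = c.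
Proof. by rewrite /mean Rintegral_cst//= probability_setT mulr1. Qed.

Lemma mean_sum (I : Type) (r : seq I) (f : I -> T -> K) :
  (forall i, intble (f i)) ->
  mean (fun x => \sum_(i <- r) f i x) = \sum_(i <- r) mean (f i).
Proof.
move=> fi; elim: r => [|i r IH].
  by under [X in mean X]eq_fun do rewrite big_nil; rewrite mean_cst big_nil.
under [X in mean X]eq_fun do rewrite big_cons.
by rewrite meanD ?IH ?big_cons//; exact: intble_sum.
Qed.

Lemma le_mean f g : intble f -> intble g -> (forall x, f x <= g x) ->
  mean f <= mean g.
Proof. by move=> fi gi fg; apply: le_Rintegral. Qed.

Lemma mean_ge0 f : (forall x, 0 <= f x) -> 0 <= mean f.
Proof. by move=> f0; exact: Rintegral_ge0. Qed.

Lemma mean_fin f : intble f -> (\int[P]_x (f x)%:E)%E = (mean f)%:E.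
Proof. by move=> fi; rewrite fineK//; exact: integrable_fin_num. Qed.

Lemma mean_cvg (f_ : nat -> T -> K) f g :
  (forall n, measurable_fun setT (f_ n)) ->
  (forall n x, `|f_ n x| <= g x) -> intble g ->
  (forall x, f_ n x @[n --> \oo] --> f x) ->
  intble f /\ mean (f_ n) @[n --> \oo] --> mean f.
Proof.
move=> mf fg gi cf.
have mlim : measurable_fun setT f.
  by apply: (measurable_fun_cvg (h := f_)) => // x _; exact: cf.
have fi n : intble (f_ n) by exact: intble_le (fg n) gi.
have [] := @dominated_convergence _ _ _ P setT measurableT
  (fun n => EFin \o f_ n) (EFin \o f) (EFin \o g).
- by move=> n; exact/measurable_EFinP.
- exact/measurable_EFinP.
- by apply: aeW => x _; apply: cvg_EFin; [exact: nearW|exact: cf].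
- exact: gi.
- by apply: aeW => x n _ /=; rewrite lee_fin.
move=> fint _ cv; split=> //.
apply: (@fine_cvg _ _ _ _ (fun n => \int[P]_x (f_ n x)%:E)%E (mean f)).
by rewrite -(mean_fin fint); exact: cv.
Qed.

Lemma mean_cvg_eq0 (f_ : nat -> T -> K) f g :
  (forall n, measurable_fun setT (f_ n)) ->
  (forall n x, `|f_ n x| <= g x) -> intble g ->
  (forall x, f_ n x @[n --> \oo] --> f x) ->
  (forall n, mean (f_ n) = 0) -> mean f = 0.
Proof.
move=> mf fg gi cf f0; have [_] := mean_cvg mf fg gi cf.
under eq_cvg do rewrite f0.
by move=> /cvg_lim <- //; rewrite lim_cst.
Qed.

Lemma sqintbleM f g : sqintble f -> sqintble g -> intble (fun x => f x * g x).
Proof.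
move=> [mf fi] [mg gi]; apply: intble_le (intbleD fi gi).
  exact: measurable_funM.
move=> x; rewrite normrM -(real_normK (num_real (f x))).
rewrite -[g x ^+ 2](real_normK (num_real _)).
have := sqr_ge0 (`|f x| - `|g x|); have := normr_ge0 (f x).
by have := normr_ge0 (g x); nra.
Qed.

Lemma sqintble_bounded f c : measurable_fun setT f -> (forall x, `|f x| <= c) ->
  sqintble f.
Proof.
move=> mf fc; split=> //; apply: intble_le (intble_cst (c ^+ 2)).
  exact: measurable_funX.
by move=> x; rewrite normrX lerXn2r ?nnegrE// (le_trans (normr_ge0 _) (fc x)).
Qed.

Lemma sqintble_cst c : sqintble (fun=> c).
Proof. by apply: (@sqintble_bounded _ `|c|) => //. Qed.

Lemma sqintble_intble f : sqintble f -> intble f.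
Proof.
move=> /sqintbleM/(_ (sqintble_cst 1)); apply: eq_integrable => // x _ /=.
by rewrite mulr1.
Qed.

Lemma sqintbleZ a f : sqintble f -> sqintble (fun x => a * f x).
Proof.
move=> [mf fi]; split; first exact: measurable_funM.
move: (intbleZ (a ^+ 2) fi); apply: eq_integrable => // x _ /=.
by rewrite exprMn.
Qed.

Lemma sqintbleD f g : sqintble f -> sqintble g -> sqintble (fun x => f x + g x).
Proof.
move=> [mf fi] [mg gi]; split; first exact: measurable_funD.
apply: intble_le (intbleZ 2 (intbleD fi gi)).
  by apply: measurable_funX; exact: measurable_funD.
move=> x; rewrite ger0_norm ?sqr_ge0//.
by have := sqr_ge0 (f x - g x); nra.
Qed.

Lemma sqintbleN f : sqintble f -> sqintble (fun x => - f x).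
Proof.
move=> /(sqintbleZ (-1)); under eq_fun do rewrite mulN1r.
by [].
Qed.

Lemma sqintbleB f g : sqintble f -> sqintble g -> sqintble (fun x => f x - g x).
Proof. by move=> fi /sqintbleN; exact: sqintbleD. Qed.

Lemma sqintble_sum (I : Type) (r : seq I) (f : I -> T -> K) :
  (forall i, sqintble (f i)) -> sqintble (fun x => \sum_(i <- r) f i x).
Proof.
move=> fi; elim: r => [|i r IH].
  by under eq_fun do rewrite big_nil; exact: sqintble_cst.
by under eq_fun do rewrite big_cons; exact: sqintbleD.
Qed.

Lemma sqintbleMbounded f g c : sqintble f -> measurable_fun setT g ->
  (forall x, `|g x| <= c) -> sqintble (fun x => f x * g x).
Proof.
move=> [mf fi] mg gc; split; first exact: measurable_funM.
have := @intbleMbounded _ (fun x => g x ^+ 2) (c ^+ 2) fi (measurable_funX _ mg).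
under [X in _ -> intble X]eq_fun do rewrite exprMn.
apply => x; rewrite normrX lerXn2r ?nnegrE//.
exact: le_trans (normr_ge0 _) (gc x).
Qed.

(** Dynkin's theorem: the sets on which [V] has mean zero form a lambda
system, by linearity and dominated convergence. *)
Lemma orthogonal_sigma_algebra_set (G : set (set T)) V :
  setI_closed G -> G `<=` measurable -> G setT -> intble V ->
  (forall C, G C -> mean (fun x => V x * \1_C x) = 0) ->
  forall C, <<s G >> C -> mean (fun x => V x * \1_C x) = 0.
Proof.
move=> GI Gm GT Vi VG.
have indi C : measurable C -> intble (fun x => V x * \1_C x).
  move=> mC; apply: (@intbleMbounded V \1_C 1) => //.
  by move=> x; rewrite indicE; case: (_ \in _); rewrite ?normr1 ?normr0.
pose H C := measurable C /\ mean (fun x => V x * \1_C x) = 0.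
suff : <<s G >> `<=` H by move=> GH C /GH[].
apply: (lambda_system_subset GI (D := setT) (H := H)) => //; last first.
- by move=> C GC; split; [exact: Gm|exact: VG].
split=> [//||A B BA [mA VA] [mB VB]|F ndF HF].
- by split=> //; exact: VG.
- split; first exact: measurableD.
  rewrite -[RHS](subrr 0) -{1}VA -VB -meanB ?indi//; congr mean.
  apply/funext => x; rewrite -mulrBr; congr (_ * _).
  rewrite !indicE in_setD; have [xB|xB] := boolP (x \in B).
    by rewrite (_ : x \in A) ?subrr// inE; apply: BA; rewrite -inE.
  by rewrite andbT subr0.
- have mF n : measurable (F n) by have [] := HF n.
  have mUF : measurable (\bigcup_n F n) by exact: bigcupT_measurable.
  split=> //; apply: (@mean_cvg_eq0 (fun n x => V x * \1_(F n) x) _ (fun x => `|V x|)).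
  + by move=> n; exact/intble_measurable/indi.
  + by move=> n x; rewrite normrM ler_piMr// indicE; case: (_ \in _); rewrite ?normr1 ?normr0.
  + exact: intble_norm.
  + move=> x; apply: cvgM; first exact: cvg_cst.
    have [[n _ Fnx]|nF] := pselect ((\bigcup_n F n) x).
      rewrite [X in _ --> X]indicE mem_set; last by exists n.
      apply: cvg_near_cst; exists n => // k /= nk.
      by rewrite indicE mem_set//; move/subsetPset: (ndF _ _ nk); exact.
    rewrite [X in _ --> X]indicE memNset//; apply: cvg_near_cst.
    by apply: nearW => k; rewrite indicE memNset// => Fkx; apply: nF; exists k.
  + by move=> n; have [] := HF n.
Qed.

Lemma orthogonal_sigma_algebra_ge0 (G : set (set T)) V f :
  setI_closed G -> G `<=` measurable -> G setT -> intble V ->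
  (forall C, G C -> mean (fun x => V x * \1_C x) = 0) ->
  measurable_fun setT (f : g_sigma_algebraType G -> K) ->
  (forall x, 0 <= f x) -> intble (fun x => V x * f x) ->
  mean (fun x => V x * f x) = 0.
Proof.
move=> GI Gm GT Vi VG mf f0 Vfi.
have mG (C : set T) : <<s G >> C -> d.-measurable C.
  exact: (smallest_sub (@sigma_algebra_measurable _ T) Gm).
have mf' : measurable_fun [set: g_sigma_algebraType G] (EFin \o f).
  exact/measurable_EFinP.
pose g := nnsfun_approx measurableT mf'.
have gcvg x : g n x @[n --> \oo] --> f x.
  have /fine_cvgP[_] : (g n x)%:E @[n --> \oo] --> (f x)%:E.
    exact: (cvg_nnsfun_approx measurableT mf' (fun x _ => f0 x) I).
  by [].
have gf n x : g n x <= f x.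
  rewrite -(cvg_lim _ (gcvg x))//; apply: nondecreasing_cvgn_le.
    move=> p q pq.
    by have /lefP := nd_nnsfun_approx measurableT mf' pq; exact.
  by apply/cvg_ex; exists (f x).
have gm n (B : set K) : measurable B -> <<s G >> (g n @^-1` B).
  by move=> mB; exact: (measurable_funPTI (g n) mB).
apply: (@mean_cvg_eq0 (fun n x => V x * g n x) _ (fun x => `|V x * f x|)).
- move=> n; apply: measurable_funM; first exact: intble_measurable.
  by move=> _ B mB; rewrite setTI; apply: mG; exact: (gm n B mB).
- move=> n x; rewrite !normrM ler_wpM2l//  (ger0_norm (f0 x)).
  by rewrite ger0_norm ?gf//; exact: fun_ge0.
- exact: intble_norm.
- by move=> x; apply: cvgM; [exact: cvg_cst|exact: gcvg].
move=> n; under [X in mean X]eq_fun do rewrite fimfunEord mulr_sumr.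
have Vind (C : set T) : <<s G >> C -> intble (fun x => V x * \1_C x).
  move=> /mG mC; apply: (@intbleMbounded V \1_C 1) => //.
  by move=> x; rewrite indicE; case: (_ \in _); rewrite ?normr1 ?normr0.
have ms (y : K) : <<s G >> (g n @^-1` [set y]) by apply: gm; exact: measurable_set1.
rewrite mean_sum => [|i].
  rewrite big1// => i _; under [X in mean X]eq_fun do rewrite mulrCA.
  rewrite meanZ; last exact: Vind.
  by rewrite (orthogonal_sigma_algebra_set GI Gm GT Vi VG) ?mulr0.
by under eq_fun do rewrite mulrCA; exact/intbleZ/Vind.
Qed.

(** A variable that has mean zero on a pi-system [G] is orthogonal to all
square integrable functions measurable for the sigma-algebra generated by [G];
this plays the role of the statement that the conditional expectation of [V]
vanishes. *)
Lemma orthogonal_sigma_algebra (G : set (set T)) V f :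
  setI_closed G -> G `<=` measurable -> G setT -> sqintble V ->
  (forall C, G C -> mean (fun x => V x * \1_C x) = 0) ->
  measurable_fun setT (f : g_sigma_algebraType G -> K) -> sqintble f ->
  mean (fun x => V x * f x) = 0.
Proof.
move=> GI Gm GT V2 VG mf f2.
have Vi := sqintble_intble V2.
have pos2 (h : T -> K) : sqintble h -> sqintble (fun x => Num.max (h x) 0).
  move=> [mh hi]; have mm : measurable_fun setT (fun x => Num.max (h x) 0).
    exact: measurable_maxr.
  split=> //; apply: intble_le hi; first exact: measurable_funX.
  move=> x; rewrite ger0_norm ?sqr_ge0//.
  by have [_|_] := leP (h x) 0; rewrite ?expr0n ?sqr_ge0.
have f20 := pos2 _ f2; have f20' := pos2 _ (sqintbleN f2).
have -> : (fun x => V x * f x) =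
    (fun x => V x * Num.max (f x) 0 - V x * Num.max (- f x) 0).
  apply/funext => x; rewrite -mulrBr; congr (_ * _).
  by have [h|h] := leP (f x) 0; have [h'|h'] := leP (- f x) 0; lra.
rewrite meanB; [|exact: sqintbleM..].
rewrite !(orthogonal_sigma_algebra_ge0 GI Gm GT Vi VG) ?subrr//.
- by apply: measurable_maxr => //; exact: measurableT_comp.
- by move=> x; rewrite le_max lexx orbT.
- exact: sqintbleM.
- exact: measurable_maxr.
- by move=> x; rewrite le_max lexx orbT.
- exact: sqintbleM.
Qed.

End integrals.

(** * Approximation of indicators by trigonometric polynomials *)
Section real_limits.
Context {K : realType}.

(** The polynomials [(1 - t^n)^(2^n)] tend to the indicator of [t < 1/2] on
[0, 1] away from [1/2]; the two Bernoulli inequalities give the two sides. *)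
Lemma bernoulli_ineq (t : K) n : 0 <= t <= 1 -> 1 - n%:R * t <= (1 - t) ^+ n.
Proof.
move=> /andP[t0 t1]; elim: n => [|n IH]; first by rewrite mul0r subr0 expr0.
rewrite exprS; apply: (@le_trans _ _ ((1 - t) * (1 - n%:R * t))).
  by rewrite -natr1; have := ler0n K n; nra.
by rewrite ler_wpM2l// subr_ge0.
Qed.

Lemma bernoulli_ineq_pos (t : K) n : 0 <= t -> 1 + n%:R * t <= (1 + t) ^+ n.
Proof.
move=> t0; elim: n => [|n IH]; first by rewrite mul0r addr0 expr0.
rewrite exprS; apply: (@le_trans _ _ ((1 + t) * (1 + n%:R * t))).
  by rewrite -natr1; have := ler0n K n; nra.
by rewrite ler_wpM2l// addr_ge0.
Qed.

Lemma step_power_cvg1 (t : K) : 0 <= t < 2^-1 ->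
  (1 - t ^+ n) ^+ (2 ^ n) @[n --> \oo] --> (1 : K).
Proof.
move=> /andP[t0 t2]; have t1 : t <= 1 by lra.
apply: (@squeeze_cvgr _ _ _ _ (fun n => 1 - (2 * t) ^+ n) (fun=> 1)).
- apply: nearW => n; rewrite exprMn -natrX bernoulli_ineq/=; last first.
    by rewrite exprn_ge0// exprn_ile1.
  by rewrite exprn_ile1 ?subr_ge0 ?exprn_ile1// lerBlDr lerDl exprn_ge0.
- rewrite -[X in _ --> X]subr0; apply: cvgB; first exact: cvg_cst.
  by apply: cvg_expr; rewrite ger0_norm ?mulr_ge0//; lra.
- exact: cvg_cst.
Qed.

Lemma step_power_cvg0 (t : K) : 2^-1 < t <= 1 ->
  (1 - t ^+ n) ^+ (2 ^ n) @[n --> \oo] --> (0 : K).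
Proof.
move=> /andP[t2 t1]; have t0 : 0 < t by lra.
have tn n : 0 <= t ^+ n <= 1 by have t0' := ltW t0; rewrite exprn_ge0// exprn_ile1.
apply: (@squeeze_cvgr _ _ _ _ (fun=> 0) (fun n => (2 * t)^-1 ^+ n)).
- apply: nearW => n; have /andP[tn0 tn1] := tn n.
  rewrite exprn_ge0 ?subr_ge0//= exprVn -[leRHS]mul1r ler_pdivlMr ?exprn_gt0 ?mulr_gt0//.
  apply: (@le_trans _ _ ((1 - t ^+ n) ^+ (2 ^ n) * (1 + t ^+ n) ^+ (2 ^ n))).
    rewrite ler_wpM2l ?exprn_ge0 ?subr_ge0//.
    apply: le_trans (bernoulli_ineq_pos _ tn0).
    by rewrite exprMn natrX lerDr.
  rewrite -exprMn exprn_ile1//.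
    by rewrite mulr_ge0 ?subr_ge0// addr_ge0.
  by nra.
- exact: cvg_cst.
- apply: cvg_expr; rewrite ger0_norm ?invr_ge0 ?mulr_ge0 ?ltW//.
  by rewrite invf_lt1 ?mulr_gt0//; lra.
Qed.

End real_limits.

Section trigonometric_polynomials.
Context {K : realType}.

(** An inductive closure of the cosines under linear combinations.  Products
come for free from the product-to-sum formula ([trigpolyM]). *)
Inductive trigpoly : (K -> K) -> Prop :=
| trigpoly_cos a b : trigpoly (fun x => cos (a * x + b))
| trigpolyD f g : trigpoly f -> trigpoly g -> trigpoly (fun x => f x + g x)
| trigpolyZ c f : trigpoly f -> trigpoly (fun x => c * f x).

Lemma trigpoly_cst c : trigpoly (fun=> c).
Proof.
have := trigpolyZ c (trigpoly_cos 0 0).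
by under eq_fun do rewrite mul0r addr0 cos0 mulr1.
Qed.

Lemma trigpoly_sin a b : trigpoly (fun x => sin (a * x + b)).
Proof.
have := trigpoly_cos a (b - pi / 2).
by under eq_fun do rewrite addrA cosBpihalf.
Qed.

Lemma cos_mul_cos (x y : K) : cos x * cos y = 2^-1 * (cos (x + y) + cos (x - y)).
Proof. by rewrite cosD cosB; field. Qed.

Lemma trigpolyM f g : trigpoly f -> trigpoly g -> trigpoly (fun x => f x * g x).
Proof.
move=> + tg; elim: tg f => {g}[a b|g h tg IHg th IHh|c g tg IH] f tf.
- elim: tf => {f}[a' b'|f h tf IHf th IHh|c f tf IH].
  + have := trigpolyZ 2^-1 (trigpolyD (trigpoly_cos (a' + a) (b' + b))
                                      (trigpoly_cos (a' - a) (b' - b))).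
    congr trigpoly; apply/funext => x; rewrite cos_mul_cos.
    by congr (_ * (cos _ + cos _)); ring.
  + have := trigpolyD IHf IHh.
    by under eq_fun do rewrite -mulrDl.
  + have := trigpolyZ c IH.
    by under eq_fun do rewrite mulrA.
- have := trigpolyD (IHg f tf) (IHh f tf).
  by under eq_fun do rewrite -mulrDr.
- have := trigpolyZ c (IH f tf).
  by under eq_fun do rewrite mulrCA.
Qed.

Lemma trigpolyX f n : trigpoly f -> trigpoly (fun x => f x ^+ n).
Proof.
move=> tf; elim: n => [|n IH]; first exact: trigpoly_cst.
by under eq_fun do rewrite exprS; exact: trigpolyM.
Qed.

Lemma trigpolyB f g : trigpoly f -> trigpoly g -> trigpoly (fun x => f x - g x).
Proof.
move=> tf tg; have := trigpolyD tf (trigpolyZ (-1) tg).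
by under eq_fun do rewrite mulN1r.
Qed.

Lemma trigpoly_bounded f : trigpoly f -> exists c, forall x, `|f x| <= c.
Proof.
elim=> {f}[a b|f g _ [c fc] _ [c' gc]|c f _ [c' fc]].
- by exists 1 => x; rewrite ler_norml cos_geN1 cos_le1.
- by exists (c + c') => x; rewrite (le_trans (ler_normD _ _)) ?lerD.
- by exists (`|c| * c') => x; rewrite normrM ler_wpM2l.
Qed.

Lemma trigpoly_measurable f : trigpoly f -> measurable_fun setT f.
Proof.
elim=> {f}[a b|f g _ mf _ mg|c f _ mf].
- apply: measurableT_comp; last exact: measurable_funD.
  by apply: continuous_measurable_fun; exact: continuous_cos.
- exact: measurable_funD.
- exact: measurable_funM.
Qed.

(** A sequence of trigonometric polynomials with values in [[-1, 1]] that tends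
pointwise to the indicator of [sin (a (x - c)) > 0].  The first factor takes
[t = (1 - sin) / 2] in the step polynomials above; the second one, which tends
to the indicator of [sin <> 0], forces the limit 0 where [t = 1/2]. *)
Definition half_period (a c : K) n (x : K) : K :=
  (1 - (2^-1 * (1 - sin (a * (x - c)))) ^+ n) ^+ (2 ^ n)
  * (1 - (1 - sin (a * (x - c)) ^+ 2) ^+ n).

Lemma half_period_trigpoly a c n : trigpoly (half_period a c n).
Proof.
have ts : trigpoly (fun x => sin (a * (x - c))).
  have := trigpoly_sin a (- (a * c)).
  by under eq_fun do rewrite -mulrBr.
apply: trigpolyM.
  apply/trigpolyX/trigpolyB/trigpolyX/trigpolyZ/trigpolyB => //; exact: trigpoly_cst.
apply/trigpolyB/trigpolyX/trigpolyB/trigpolyX => //; exact: trigpoly_cst.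
Qed.

Lemma half_period_bound a c n x : `|half_period a c n x| <= 1.
Proof.
rewrite /half_period; set s := sin _.
have /andP[s1 s2] : -1 <= s <= 1 by rewrite sin_geN1 sin_le1.
have unit_pow (t : K) k : 0 <= t <= 1 -> 0 <= t ^+ k <= 1.
  by move=> /andP[t0 t1]; rewrite exprn_ge0 ?exprn_ile1.
have compl (t : K) : 0 <= t <= 1 -> 0 <= 1 - t <= 1 by lra.
have t1 : 0 <= 2^-1 * (1 - s) <= 1 by lra.
have t2 : 0 <= 1 - s ^+ 2 <= 1 by nra.
have /andP[p0 p1] := unit_pow _ (2 ^ n)%N (compl _ (unit_pow _ n t1)).
have /andP[q0 q1] := compl _ (unit_pow _ n t2).
by rewrite ger0_norm ?mulr_ge0// mulr_ile1.
Qed.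

Lemma half_period_cvg a c x :
  half_period a c n x @[n --> \oo] --> ((0 < sin (a * (x - c)))%R%:R : K).
Proof.
rewrite /half_period; set s := sin _.
have /andP[s1 s2] : -1 <= s <= 1 by rewrite sin_geN1 sin_le1.
have cvg2 : s != 0 -> 1 - (1 - s ^+ 2) ^+ n @[n --> \oo] --> (1 : K).
  move=> s0; rewrite -[X in _ --> X]subr0; apply: cvgB; first exact: cvg_cst.
  apply: cvg_expr; have : 0 < s ^+ 2 by rewrite lt0r sqrf_eq0 s0 sqr_ge0.
  by rewrite ltr_norml => ?; nra.
have [s_gt0|s_lt0|s_eq0] := ltrgtP 0 s.
- rewrite -[X in _ --> X]mulr1; apply: cvgM; last by apply: cvg2; rewrite gt_eqF.
  by apply: step_power_cvg1; lra.
- rewrite -[X in _ --> X](mulr1); apply: cvgM; last by apply: cvg2; rewrite lt_eqF.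
  by apply: step_power_cvg0; lra.
- apply: cvg_near_cst; apply: nearW => n.
  by rewrite -s_eq0 expr0n subr0 expr1n subrr mulr0.
Qed.

(** The half-periods grow and exhaust the half-line [x > c]. *)
Lemma sin_slow_cvg (c x : K) :
  ((0 < sin (n.+1%:R^-1 * (x - c)))%R%:R : K) @[n --> \oo] --> ((c < x)%R%:R : K).
Proof.
have small : \forall n \near \oo, `|n.+1%:R^-1 * (x - c)| < pi.
  have : n.+1%:R^-1 * (x - c) @[n --> \oo] --> (0 * (x - c)).
    by apply: cvgM; [exact: cvg_harmonic|exact: cvg_cst].
  rewrite mul0r => /cvgrPdist_lt/(_ pi (pi_gt0 _)).
  by apply: filterS => n; rewrite sub0r normrN.
apply: cvg_near_cst; apply: filterS small => n.
rewrite ltr_norml => /andP[lo hi].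
have n0 : 0 < n.+1%:R^-1 :> K by rewrite invr_gt0.
have [cx|xc] := ltP c x.
  by rewrite sin_gt0_pi// hi mulr_gt0// subr_gt0.
rewrite ltNge (_ : sin _ <= 0)//.
rewrite -[X in sin X]opprK sinN oppr_le0 sin_ge0_pi// -mulrN opprB.
rewrite mulr_ge0 ?subr_ge0 ?(ltW n0)//=.
by rewrite -opprB mulrN lerNl ltW.
Qed.

End trigonometric_polynomials.

(** * Fourier uniqueness on orthants *)
Section fourier_uniqueness.
Context d (T : measurableType d) (K : realType) (P : probability T K).
Implicit Types (V xi : T -> K).

Local Notation mean := (mean P).
Local Notation intble := (intble P).

Lemma fourier_null_trigpoly V xi f : intble V -> measurable_fun setT xi ->
  (forall a b, mean (fun x => V x * cos (a * xi x + b)) = 0) ->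
  trigpoly f -> mean (fun x => V x * f (xi x)) = 0.
Proof.
move=> Vi mxi V0.
have Vfi f' : trigpoly f' -> intble (fun x => V x * f' (xi x)).
  move=> tf; have [c fc] := trigpoly_bounded tf.
  apply: (@intbleMbounded _ _ _ _ _ _ c Vi) => //.
  exact: measurableT_comp (trigpoly_measurable tf) mxi.
elim=> {f}[a b|f g tf IHf tg IHg|c f tf IH]; first exact: V0.
  by under [X in mean X]eq_fun do rewrite mulrDr; rewrite meanD ?IHf ?IHg ?addr0 ?Vfi.
by under [X in mean X]eq_fun do rewrite mulrCA; rewrite meanZ ?IH ?mulr0 ?Vfi.
Qed.

(** Uniqueness of the Fourier transform for the signed law of [xi] under the
density [V]: trigonometric polynomials approximate the indicator of a
half-period, and slower and slower half-periods that of a half-line. *)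
Lemma fourier_null_halfline V xi c : intble V -> measurable_fun setT xi ->
  (forall a b, mean (fun x => V x * cos (a * xi x + b)) = 0) ->
  mean (fun x => V x * \1_[set y | c < xi y] x) = 0.
Proof.
move=> Vi mxi V0.
have unit01 (b : bool) : `|b%:R : K| <= 1 by case: b; rewrite ?normr1 ?normr0.
have mhalf n k : measurable_fun setT (fun x => half_period n.+1%:R^-1 c k (xi x)).
  by apply: measurableT_comp mxi; apply: trigpoly_measurable; exact: half_period_trigpoly.
have msin n : measurable_fun setT
    (fun x => (0 < sin (n.+1%:R^-1 * (xi x - c)))%R%:R : K).
  apply: (@measurable_fun_cvg _ _ _ _ (fun k x => half_period n.+1%:R^-1 c k (xi x))).
    exact: mhalf.
  by move=> x _; exact: half_period_cvg.
have sin0 n : mean (fun x => V x * (0 < sin (n.+1%:R^-1 * (xi x - c)))%R%:R) = 0.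
  apply: (@mean_cvg_eq0 _ _ _ _
    (fun k x => V x * half_period n.+1%:R^-1 c k (xi x)) _ (fun x => `|V x|)).
  - by move=> k; apply: measurable_funM; [exact: intble_measurable Vi|exact: mhalf].
  - by move=> k x; rewrite normrM ler_piMr// half_period_bound.
  - exact: intble_norm.
  - by move=> x; apply: cvgM; [exact: cvg_cst|exact: half_period_cvg].
  - by move=> k; apply: fourier_null_trigpoly => //; exact: half_period_trigpoly.
apply: (@mean_cvg_eq0 _ _ _ _
  (fun n x => V x * (0 < sin (n.+1%:R^-1 * (xi x - c)))%R%:R) _ (fun x => `|V x|)).
- by move=> n; apply: measurable_funM => //; exact: intble_measurable Vi.
- by move=> n x; rewrite normrM ler_piMr.
- exact: intble_norm.
- move=> x; apply: cvgM; first exact: cvg_cst.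
  rewrite indicE (_ : (_ \in _) = (c < xi x)); first exact: sin_slow_cvg.
  by apply/idP/idP; rewrite inE.
- exact: sin0.
Qed.

Fixpoint affine_span (s : seq (T -> K)) (f : T -> K) : Prop :=
  if s is xi :: s' then
    exists a, exists2 g, affine_span s' g & f = fun x => a * xi x + g x
  else exists b, f = fun=> b.

(** Coordinates may be left unconstrained, so that the whole space and the
half-spaces of each coordinate are orthants; orthants then form a pi-system
generating the coordinates. *)
Fixpoint orthant (s : seq (T -> K)) (C : set T) : Prop :=
  if s is xi :: s' then
    exists2 C', orthant s' C' &
      C = C' \/ exists c, C = [set x | c < xi x] `&` C'
  else C = setT.

Lemma affine_span_measurable s f :
  (forall xi, List.In xi s -> measurable_fun setT xi) ->
  affine_span s f -> measurable_fun setT f.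
Proof.
elim: s f => [f _ [b ->]|xi s IH f ms [a [g sg ->]]]; first exact: measurable_cst.
apply: measurable_funD; first by apply: measurable_funM => //; apply: ms; left.
by apply: IH sg => h sh; apply: ms; right.
Qed.

Lemma affine_spanN s f : affine_span s f -> affine_span s (fun x => - f x).
Proof.
elim: s f => [f [b ->]|xi s IH f [a [g sg ->]]]; first by exists (- b).
exists (- a), (fun x => - g x); first exact: IH.
by apply/funext => x; rewrite mulNr opprD.
Qed.

Lemma affine_spanDcst s f b : affine_span s f -> affine_span s (fun x => f x + b).
Proof.
elim: s f => [f [b' ->]|xi s IH f [a [g sg ->]]]; first by exists (b' + b).
exists a, (fun x => g x + b); first exact: IH.
by apply/funext => x; rewrite addrA.
Qed.

(** The coordinates are treated one at a time.  If the indicators of the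
coordinates already treated are absorbed into [V], what is needed for the next
coordinate [xi] is that [V cos (f)] is annihilated by [cos (a xi + b)] for [f]
an affine combination of the others, and the product-to-sum formula reduces
this to the hypothesis. *)
Lemma fourier_null_orthant s V : intble V ->
  (forall xi, List.In xi s -> measurable_fun setT xi) ->
  (forall f, affine_span s f -> mean (fun x => V x * cos (f x)) = 0) ->
  forall C, orthant s C -> mean (fun x => V x * \1_C x) = 0.
Proof.
elim: s V => [|xi s IH] V Vi ms V0 C.
  move=> ->; have := V0 (fun=> 0) (ex_intro _ 0 erefl).
  by under eq_fun do rewrite cos0; rewrite indicT.
have mxi : measurable_fun setT xi by apply: ms; left.
have ms' g : List.In g s -> measurable_fun setT g by move=> sg; apply: ms; right.
have cosb x : `|cos x : K| <= 1 by rewrite ler_norml cos_geN1 cos_le1.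
have cosi f : affine_span s f -> intble (fun x => V x * cos (f x)).
  move=> sf; apply: (@intbleMbounded _ _ _ _ _ _ 1 Vi) => //.
  apply: measurableT_comp (affine_span_measurable ms' sf).
  by apply: continuous_measurable_fun; exact: continuous_cos.
move=> [C' sC' [->|[c ->]]].
  apply: IH sC' => // f sf; apply: V0; exists 0, f => //.
  by apply/funext => x; rewrite mul0r add0r.
rewrite [X in mean X](_ : _ = fun x => V x * \1_[set y | c < xi y] x * \1_C' x); last first.
  by apply/funext => x; rewrite indicI mulrA.
have mc : measurable [set x | c < xi x].
  by rewrite -[X in measurable X]setTI; apply: measurable_fun_ltr.
apply: IH sC' => //.
  apply: (@intbleMbounded _ _ _ _ _ _ 1 Vi) => // x.
  by rewrite indicE; case: (_ \in _); rewrite ?normr1 ?normr0.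
move=> f sf; under [X in mean X]eq_fun do rewrite mulrAC.
apply: fourier_null_halfline => //; first exact: cosi.
move=> a b.
pose f1 x := a * xi x + (f x + b); pose f2 x := a * xi x + (- f x + b).
have s1 : affine_span (xi :: s) f1.
  by exists a, (fun x => f x + b) => //; exact: affine_spanDcst.
have s2 : affine_span (xi :: s) f2.
  by exists a, (fun x => - f x + b) => //; exact/affine_spanDcst/affine_spanN.
have i12 g : affine_span (xi :: s) g -> intble (fun x => V x * cos (g x)).
  move=> sg; apply: (@intbleMbounded _ _ _ _ _ _ 1 Vi) => //.
  apply: measurableT_comp (affine_span_measurable ms sg).
  by apply: continuous_measurable_fun; exact: continuous_cos.
rewrite [X in mean X](_ : _ =
    fun x => 2^-1 * (V x * cos (f1 x) + V x * cos (f2 x))); last first.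
  apply/funext => x; rewrite -mulrA cos_mul_cos mulrCA -mulrDr -(cosN (f x - _)).
  by congr (_ * (_ * (cos _ + cos _))); rewrite /f1 /f2; ring.
rewrite meanZ; last by apply: intbleD; exact: i12.
by rewrite meanD ?V0 ?addr0 ?mulr0//; exact: i12.
Qed.

Lemma orthant_setI s : setI_closed (orthant s).
Proof.
elim: s => [|xi s IH] C D; first by move=> -> ->; rewrite setIid.
move=> [C' sC' CE] [D' sD' DE]; exists (C' `&` D'); first exact: IH.
case: CE DE => [->|[c ->]] [->|[e ->]]; [by left|right..].
- by exists e; rewrite setICA.
- by exists c; rewrite setIA.
- exists (Num.max c e); rewrite setIACA; congr (_ `&` _).
  by apply/seteqP; split => x /=; rewrite gt_max => /andP.
Qed.

Lemma orthant_measurable s : (forall xi, List.In xi s -> measurable_fun setT xi) ->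
  orthant s `<=` measurable.
Proof.
elim: s => [|xi s IH] ms C; first by move=> ->.
have ms' g : List.In g s -> measurable_fun setT g by move=> sg; apply: ms; right.
move=> [C' /(IH ms') mC' [->//|[c ->]]]; apply: measurableI => //.
rewrite -[X in measurable X]setTI; apply: measurable_fun_ltr => //.
by apply: ms; left.
Qed.

Lemma orthant_setT s : orthant s setT.
Proof. by elim: s => [//|xi s IH]; exists setT => //; left. Qed.

Lemma orthant_halfline s xi c : List.In xi s -> orthant s [set x | c < xi x].
Proof.
elim: s => [//|h s IH] [->|/IH sxi]; last by exists [set x | c < xi x] => //; left.
exists setT; first exact: orthant_setT.
by right; exists c; rewrite setIT.
Qed.

Lemma orthant_measurable_fun s xi : List.In xi s ->
  measurable_fun setT (xi : g_sigma_algebraType (orthant s) -> K).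
Proof.
move=> sxi; apply: (measurability _ (RGenOInfty.measurableE K)).
move=> _ [_ [c ->] <-]; apply: sub_sigma_algebra; rewrite setTI.
rewrite (_ : _ @^-1` _ = [set x | c < xi x]); first exact: orthant_halfline.
by apply/seteqP; split=> x /=; rewrite in_itv/= andbT.
Qed.

End fourier_uniqueness.

Definition affine (K : realType) (m s y : K) : K := m + s * y.

Lemma measurable_affine (K : realType) (m s : K) :
  measurable_fun setT (affine m s).
Proof. by apply: measurable_funD => //; apply: measurable_funM. Qed.

(** * Centred normal variables of equal variance *)
Section normal_law.
Context {K : realType}.
Local Notation mu := (@lebesgue_measure K).

(** By translation and scaling this is Lebesgue measure again
([lebesgue_measure_affine]); the density of the normal law with parameters
[m], [s] then becomes that of the standard one ([normal_prob_affine]). *)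
Definition affine_image_lebesgue (m s : K) (s0 : 0 < s) :
  {measure set (measurableTypeR K) -> \bar K}.
Proof.
refine (mscale (NngNum (ltW s0))
  (pushforward mu (affine m s : measurableTypeR K -> measurableTypeR K))).
exact: measurable_affine.
Defined.

Lemma lebesgue_measure_affine (m s : K) (s0 : 0 < s) (A : set K) :
  measurable A -> mu A = affine_image_lebesgue m s0 A.
Proof.
apply: lebesgue_measure_unique => _ [[a b] _ <-].
rewrite /affine_image_lebesgue /= /mscale /= /pushforward.
rewrite (_ : _ @^-1` _ = `](a - m) / s, (b - m) / s]%classic); last first.
  apply/seteqP; split => y /=; rewrite !in_itv/= ltr_pdivrMr// ler_pdivlMr//;
  by rewrite ltrBlDl lerBrDl (mulrC y).
rewrite !lebesgue_measure_itv/= !lte_fin.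
rewrite ltr_pM2r ?invr_gt0// ltrD2r.
case: ifP => _; last by rewrite mule0.
rewrite -!EFinB -EFinM -mulrBl mulrC divfK ?gt_eqF//; congr EFin; lra.
Qed.

Lemma normal_pdf_affine (m s y : K) : 0 < s ->
  s * normal_pdf m s (affine m s y) = normal_pdf 0 1 y.
Proof.
move=> s0; rewrite !normal_pdfE ?gt_eqF// /normal_peak /normal_fun /affine.
rewrite addrAC subrr add0r subr0 exprMn expr1n mulrA; congr (_ * expR _).
  rewrite mul1r -mulrnAr sqrtrM ?sqr_ge0// sqrtr_sqr gtr0_norm// invfM.
  by rewrite mulVKf// gt_eqF.
by rewrite -mulr_natr -(mulr_natr 1) mul1r invfM mulrA -mulNr; field; rewrite gt_eqF.
Qed.

Lemma normal_prob_affine (m s : K) (E : set K) : 0 < s -> measurable E ->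
  normal_prob m s E = normal_prob 0 1 (affine m s @^-1` E).
Proof.
move=> s0 mE; rewrite /normal_prob.
have mpdf : measurable_fun E (fun x => (normal_pdf m s x)%:E).
  by apply: measurable_funTS; apply/measurable_EFinP; exact: measurable_normal_pdf.
rewrite (eq_measure_integral (affine_image_lebesgue m s0)); last first.
  by move=> A mA _; exact: lebesgue_measure_affine.
rewrite ge0_integral_mscale//=; last by move=> x _; rewrite lee_fin normal_pdf_ge0.
rewrite ge0_integral_pushforward//=; last by move=> x _; rewrite lee_fin normal_pdf_ge0.
rewrite -ge0_integralZl//=.
- by apply: eq_integral => y _; rewrite -EFinM normal_pdf_affine.
- by rewrite -[X in measurable X]setTI; exact: measurable_affine.
- apply: measurable_funTS; apply/measurable_EFinP.
  by apply: measurableT_comp (measurable_affine m s); exact: measurable_normal_pdf.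
- by move=> y _; rewrite lee_fin normal_pdf_ge0.
- by rewrite lee_fin ltW.
- exact: measurable_affine.
Qed.

End normal_law.

Section gaussian_moments.
Context d (T : measurableType d) (K : realType) (P : probability T K).
Implicit Types U V : T -> K.
Local Notation gamma := (@normal_prob K 0 1).

(** All normal laws, including the constants, for which [s = 0], are affine
images of a single one. *)
Lemma gaussian_rv_affine U : gaussian_rv P U ->
  exists m s : K, 0 <= s /\
    forall E, measurable E -> P (U @^-1` E) = gamma (affine m s @^-1` E).
Proof.
move=> [m [dirac|[s s0 norm]]].
  exists m, 0; split=> // E mE; rewrite dirac// diracE.
  have aff y : affine m 0 y = m by rewrite /affine mul0r addr0.
  have [Em|Em] := boolP (m \in E).
    rewrite (_ : _ @^-1` _ = setT); first exact/esym/probability_setT.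
    by apply/seteqP; split=> // y _ /=; rewrite aff -inE.
  rewrite (_ : _ @^-1` _ = set0) ?measure0//.
  by apply/seteqP; split=> // y /=; rewrite aff -inE (negbTE Em).
exists m, s; split=> [|E mE]; first exact: ltW.
by rewrite norm// normal_prob_affine.
Qed.

Lemma gaussian_integral U m s (f : K -> K) : measurable_fun setT U ->
  (forall E, measurable E -> P (U @^-1` E) = gamma (affine m s @^-1` E)) ->
  measurable_fun setT f -> (forall y, 0 <= f y) ->
  (\int[P]_x (f (U x))%:E = \int[gamma]_y (f (affine m s y))%:E)%E.
Proof.
move=> mU lawU mf f0.
have mE : measurable_fun setT (EFin \o f) by exact/measurable_EFinP.
have maff : measurable_fun [set: measurableTypeR K]
    (affine m s : measurableTypeR K -> K) by exact: measurable_affine.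
have E0 : {in [set: K], forall y, (0 <= (EFin \o f) y)%E} by move=> y _; rewrite lee_fin.
transitivity (\int[pushforward P U]_y (f y)%:E)%E.
  by rewrite (ge0_integral_pushforward mU P measurableT mE E0).
transitivity (\int[pushforward gamma (affine m s)]_y (f y)%:E)%E.
  by apply: eq_measure_integral => A mA _; exact: lawU.
by rewrite (@ge0_integral_pushforward _ _ _ _ _ _ maff gamma _ (EFin \o f) measurableT mE E0).
Qed.

Lemma normal_sqr_gt0 (a : K) : (0 < \int[gamma]_y ((y + a) ^+ 2)%:E)%E.
Proof.
rewrite lt0e; apply/andP; split; last first.
  by apply: integral_ge0 => y _; rewrite lee_fin sqr_ge0.
apply/eqP => h0.
have msq : measurable_fun [set: measurableTypeR K] (fun y => ((y + a) ^+ 2)%:E).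
  by apply/measurable_EFinP; apply: measurable_funX; exact: measurable_funD.
have := (ae_eq_integral_abs gamma measurableT msq).1.
under eq_integral do rewrite gee0_abs ?lee_fin ?sqr_ge0//.
move=> /(_ h0) [N [mN N0 subN]].
have g1 : (gamma [set (- a)%R] = 0)%E by rewrite /normal_prob integral_set1.
have : (gamma setT <= gamma [set (- a)%R] + gamma N)%E.
  have m1 : measurable ([set - a] : set (measurableTypeR K)) by exact: measurable_set1.
  apply: le_trans (measureU2 gamma m1 mN).
  apply: le_measure; rewrite ?inE//; first exact: measurableU.
  move=> y _ /=; have [->|ya] := eqVneq y (- a); [by left|right; apply: subN => /= /(_ I)].
  by move=> /eqP; rewrite eqe sqrf_eq0 addr_eq0 (negbTE ya).
by rewrite g1 N0 adde0 probability_setT leNgt lte01.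
Qed.

(** The parameters are recovered without computing any Gaussian integral: the
mean of [(U + c)^2] is [v + c^2] for every [c], which by the affine
representation determines the function [a |-> E (y + a)^2] of the standard
law, a quadratic polynomial with minimum [v / s^2] at [m / s]. *)
Lemma centered_gaussian_params U m s : 0 <= s -> sqintble P U -> mean P U = 0 ->
  (forall E, measurable E -> P (U @^-1` E) = gamma (affine m s @^-1` E)) ->
  let v := mean P (fun x => U x ^+ 2) in
  (s = 0 /\ m = 0 /\ v = 0) \/
  (0 < s /\ 0 < v /\
   forall a, (\int[gamma]_y ((y + a) ^+ 2)%:E = ((v + (s * a - m) ^+ 2) / s ^+ 2)%:E)%E).
Proof.
move=> s0 U2 EU lawU v.
have Ui := sqintble_intble U2.
have shift c : (\int[gamma]_y ((affine m s y + c) ^+ 2)%:E = (v + c ^+ 2)%:E)%E.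
  have <- := @gaussian_integral U m s (fun y => (y + c) ^+ 2) U2.1 lawU.
  - have e : (fun x => (U x + c) ^+ 2) = (fun x => U x ^+ 2 + (2 * c * U x + c ^+ 2)).
      by apply/funext => x; ring.
    have i1 : intble P (fun x => 2 * c * U x + c ^+ 2).
      by apply: intbleD; [exact: intbleZ|exact: intble_cst].
    have i2 : intble P (fun x => U x ^+ 2) by case: U2.
    rewrite mean_fin e; last exact: intbleD.
    rewrite meanD// meanD; [|exact: intbleZ|exact: intble_cst].
    by rewrite (meanZ _ Ui) EU mean_cst mulr0 add0r.
  - by apply: measurable_funX; exact: measurable_funD.
  - by move=> y; exact: sqr_ge0.
have [s_eq0|s_neq0] := eqVneq s 0.
  left; have cst c : v + c ^+ 2 = (m + c) ^+ 2.
    have := shift c; rewrite s_eq0.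
    under eq_integral do rewrite /affine mul0r addr0.
    by rewrite integral_cst//= probability_setT mule1 => -[].
  have := cst 0; have := cst 1 => h1 h0.
  have m0 : m = 0 by nra.
  by move: h0; rewrite m0; split=> //; split=> //; nra.
right; have s_gt0 : 0 < s by rewrite lt0r s_neq0.
have quad a : (\int[gamma]_y ((y + a) ^+ 2)%:E = ((v + (s * a - m) ^+ 2) / s ^+ 2)%:E)%E.
  have := shift (s * a - m).
  rewrite [X in X = _ -> _](_ : _ = (s ^+ 2)%:E * \int[gamma]_y ((y + a) ^+ 2)%:E)%E; last first.
    rewrite -ge0_integralZl//=.
    + by apply: eq_integral => y _; rewrite -EFinM /affine; congr EFin; ring.
    + by apply/measurable_EFinP; apply: measurable_funX; exact: measurable_funD.
    + by move=> y _; rewrite lee_fin sqr_ge0.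
    + by rewrite lee_fin sqr_ge0.
  move=> h; rewrite mulrC EFinM -h muleA -EFinM mulVf ?mul1e// sqrf_eq0 gt_eqF//.
split=> //; split=> //.
have := normal_sqr_gt0 (m / s); rewrite quad (mulrC s) divfK// subrr expr0n/= addr0.
by rewrite lte_fin pmulr_lgt0// invr_gt0 exprn_gt0.
Qed.

(** The minimum of the polynomial of [centered_gaussian_params] and the point
where it is attained belong to the standard law, hence are common to [U] and
[V]. *)
Lemma centered_gaussian_same_law U V : gaussian_rv P U -> gaussian_rv P V ->
  sqintble P U -> sqintble P V -> mean P U = 0 -> mean P V = 0 ->
  mean P (fun x => U x ^+ 2) = mean P (fun x => V x ^+ 2) ->
  forall f : K -> K, measurable_fun setT f -> (forall y, 0 <= f y) ->
  (\int[P]_x (f (U x))%:E = \int[P]_x (f (V x))%:E)%E.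
Proof.
move=> /gaussian_rv_affine[m [s [s0 lawU]]] /gaussian_rv_affine[m' [s' [s0' lawV]]].
move=> U2 V2 EU EV UV f mf f0.
rewrite (gaussian_integral U2.1 lawU mf f0) (gaussian_integral V2.1 lawV mf f0).
suff [-> ->] : m = m' /\ s = s' by [].
have := centered_gaussian_params s0 U2 EU lawU.
have := centered_gaussian_params s0' V2 EV lawV.
rewrite UV; set v := mean _ _ => /= -[[-> [-> v0]]|[s'_gt0 [v_gt0 quad']]].
  by case=> [[-> [-> _]]//|[_ [+ _]]]; rewrite v0 ltxx.
case=> [[_ [_ v0]]|[s_gt0 [_ quad]]]; first by rewrite v0 ltxx in v_gt0.
have E a : (v + (s * a - m) ^+ 2) / s ^+ 2 = (v + (s' * a - m') ^+ 2) / s' ^+ 2.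
  by apply: EFin_inj; rewrite -quad -quad'.
pose p := m / s; pose p' := m' / s'; pose q := v / s ^+ 2; pose q' := v / s' ^+ 2.
have Eq a : q + (a - p) ^+ 2 = q' + (a - p') ^+ 2.
  have := E a; rewrite /q /q' /p /p'.
  rewrite (_ : (v + (s * a - m) ^+ 2) / s ^+ 2 = v / s ^+ 2 + (a - m / s) ^+ 2); last first.
    by field; rewrite gt_eqF.
  rewrite (_ : (v + (s' * a - m') ^+ 2) / s' ^+ 2 = v / s' ^+ 2 + (a - m' / s') ^+ 2) //.
  by field; rewrite gt_eqF.
have pp : p = p' by have := Eq 0; have := Eq 1; lra.
have qq : q = q' by have := Eq 0; rewrite pp; lra.
have ss : s = s'.
  apply/eqP; rewrite -(@eqrXn2 _ 2)//.
  have := qq; rewrite /q /q' => /(mulfI (lt0r_neq0 v_gt0))/invr_inj ->.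
  by [].
split=> //; move: pp; rewrite /p /p' ss => /(mulIf _); apply.
by rewrite invr_eq0 gt_eqF.
Qed.

End gaussian_moments.

(** * Uncorrelated jointly normal variables *)
Section sine_bounds.
Context {K : realType}.

Lemma sin_mean_value (x : K) : exists2 c, `|c| <= `|x| & sin x = cos c * x.
Proof.
wlog x0 : x / 0 <= x.
  move=> H; have [/H//|/ltW x0] := leP 0 x.
  have [|c cx sc] := H (- x); first by rewrite oppr_ge0.
  exists c; first by rewrite normrN in cx.
  by apply: oppr_inj; rewrite -sinN sc mulrN.
have [c /itvP cx] := MVT_segment x0 (fun y _ => is_derive_sin y)
  (@continuous_subspaceT _ _ _ _ (@continuous_sin K)).
rewrite sin0 !subr0 => sx; exists c => //.
by rewrite !ger0_norm ?cx.
Qed.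

Lemma ler_norm_sin (x : K) : `|sin x| <= `|x|.
Proof.
have [c _ ->] := sin_mean_value x.
by rewrite normrM ler_piMl// ler_norml cos_geN1 cos_le1.
Qed.

Lemma cos_sub1_bound (x : K) : `|cos x - 1| <= `|x|.
Proof.
wlog x0 : x / 0 <= x.
  move=> H; have [/H//|/ltW x0] := leP 0 x.
  by rewrite -cosN -[`|x|]normrN; apply: H; rewrite oppr_ge0.
have [c /itvP cx] := MVT_segment x0 (fun y _ => is_derive_cos y)
  (@continuous_subspaceT _ _ _ _ (@continuous_cos K)).
rewrite cos0 subr0 => ->; rewrite normrM normrN ler_piMl//.
by rewrite ler_norml sin_geN1 sin_le1.
Qed.

Lemma sin_sub_bound (x : K) : `|sin x - x| <= x ^+ 2.
Proof.
have [c cx ->] := sin_mean_value x.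
rewrite -[X in _ - X]mul1r -mulrBl normrM -real_normK ?num_real// expr2 ler_wpM2r//.
exact: le_trans (cos_sub1_bound c) cx.
Qed.

Lemma scaled_sin_cvg (y : K) :
  n.+1%:R * sin (n.+1%:R^-1 * y) @[n --> \oo] --> y.
Proof.
apply/cvgrPdist_le => e e0.
have : y ^+ 2 * n.+1%:R^-1 @[n --> \oo] --> y ^+ 2 * 0.
  by apply: cvgM; [exact: cvg_cst|exact: cvg_harmonic].
rewrite mulr0 => /cvgrPdist_le/(_ e e0); apply: filterS => n.
rewrite sub0r normrN; apply: le_trans.
have n0 : n.+1%:R != 0 :> K by rewrite pnatr_eq0.
rewrite distrC.
rewrite -[X in _ - X](mulVKf n0) -mulrBr normrM.
rewrite [leRHS](_ : _ = `|n.+1%:R| * `|(n.+1%:R^-1 * y) ^+ 2|).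
  by rewrite ler_wpM2l// (le_trans (sin_sub_bound _))// ler_norm.
by rewrite -normrM; congr (`|_|); field.
Qed.

End sine_bounds.

Section gaussian_uncorrelated.
Context d (T : measurableType d) (K : realType) (P : probability T K).
Implicit Types th eta : T -> K.
Local Notation mean := (mean P).

(** [th + c eta] and [th - c eta] have the same variance, as [th] and [eta] are
uncorrelated, hence the same law.  Equality of the means of their sines,
shifted by [b], reads [E [cos (th + b) sin (c eta)] = 0]; divide by [c] and let
it tend to 0. *)
Lemma gaussian_uncorrelated_null th eta b : sqintble P th -> sqintble P eta ->
  mean th = 0 -> mean eta = 0 -> mean (fun x => th x * eta x) = 0 ->
  (forall c, gaussian_rv P (fun x => th x + c * eta x)) ->
  mean (fun x => eta x * cos (th x + b)) = 0.
Proof.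
move=> th2 eta2 Eth Eeta Ecov gauss.
have mth : measurable_fun setT th by case: th2.
have meta : measurable_fun setT eta by case: eta2.
have msin : measurable_fun setT (@sin K).
  by apply: continuous_measurable_fun; exact: continuous_sin.
have mcos : measurable_fun setT (@cos K).
  by apply: continuous_measurable_fun; exact: continuous_cos.
have U2 c : sqintble P (fun x => th x + c * eta x).
  by apply: sqintbleD => //; exact: sqintbleZ.
have EU c : mean (fun x => th x + c * eta x) = 0.
  rewrite meanD ?meanZ ?Eth ?Eeta ?mulr0 ?addr0//; try exact: sqintble_intble.
  exact/intbleZ/sqintble_intble.
have VU c : mean (fun x => (th x + c * eta x) ^+ 2) =
    mean (fun x => th x ^+ 2) + c ^+ 2 * mean (fun x => eta x ^+ 2).
  have -> : (fun x => (th x + c * eta x) ^+ 2) =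
      (fun x => th x ^+ 2 + (2 * c * (th x * eta x) + c ^+ 2 * eta x ^+ 2)).
    by apply/funext => x; ring.
  have i1 : intble P (fun x => 2 * c * (th x * eta x)) by exact/intbleZ/sqintbleM.
  have i2 : intble P (fun x => c ^+ 2 * eta x ^+ 2) by apply: intbleZ; case: eta2.
  have i3 : intble P (fun x => th x ^+ 2) by case: th2.
  rewrite meanD//; last exact: intbleD.
  rewrite meanD// (meanZ (2 * c)) ?Ecov ?mulr0 ?add0r; last exact: sqintbleM.
  by rewrite meanZ//; case: eta2.
have sini c : intble P (fun x => sin (th x + c * eta x + b)).
  apply: (@intble_le _ _ _ _ _ (fun=> 1)); last exact: intble_cst.
    by apply: measurableT_comp => //; apply: measurable_funD => //; case: (U2 c).
  by move=> x; rewrite ler_norml sin_geN1 sin_le1.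
have same c : mean (fun x => sin (th x + c * eta x + b)) =
              mean (fun x => sin (th x + (- c) * eta x + b)).
  have mf : measurable_fun setT (fun y : K => 1 + sin (y + b)).
    apply: measurable_funD => //; apply: measurableT_comp => //.
    exact: measurable_funD.
  have f0 (y : K) : 0 <= 1 + sin (y + b).
    by rewrite -lerBlDl sub0r sin_geN1.
  have := @centered_gaussian_same_law _ _ _ P _ _ (gauss c) (gauss (- c))
    (U2 c) (U2 (- c)) (EU c) (EU (- c)) _ _ mf f0.
  rewrite !VU sqrrN => /(_ erefl).
  rewrite !mean_fin => [[]||]; rewrite ?meanD ?mean_cst//; try exact: intble_cst.
  - by move/addrI.
  - by apply: intbleD; [exact: intble_cst|exact: sini].
  - by apply: intbleD; [exact: intble_cst|exact: sini].
have mcosth : measurable_fun setT (fun x => cos (th x + b)).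
  by apply: measurableT_comp => //; exact: measurable_funD.
have mscaled (c : K) : measurable_fun setT (fun x => sin (c * eta x)).
  by apply: measurableT_comp => //; exact: measurable_funM.
have sin_cos0 c : mean (fun x => cos (th x + b) * sin (c * eta x)) = 0.
  have -> : (fun x => cos (th x + b) * sin (c * eta x)) =
      (fun x => 2^-1 * (sin (th x + c * eta x + b) - sin (th x + (- c) * eta x + b))).
    apply/funext => x; rewrite addrAC [in X in _ - X]addrAC mulNr sinD sinB.
    by field.
  rewrite (meanZ _ (intbleB (sini c) (sini (- c)))) (meanB (sini c) (sini (- c))).
  by rewrite (same c) subrr mulr0.
(* [c = 1 / (n + 1)], dominated by [|eta|] since [|sin y| <= |y|] *)
apply: (@mean_cvg_eq0 _ _ _ P
  (fun n x => n.+1%:R * (cos (th x + b) * sin (n.+1%:R^-1 * eta x))) _ (fun x => `|eta x|)).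
- by move=> n; apply: measurable_funM => //; exact: measurable_funM.
- move=> n x; rewrite !normrM mulrCA.
  have c1 : `|cos (th x + b)| <= 1 by rewrite ler_norml cos_geN1 cos_le1.
  apply: (@le_trans _ _ (1 * (`|n.+1%:R| * `|n.+1%:R^-1 * eta x|))).
    by rewrite ler_pM ?mulr_ge0// ler_wpM2l// ler_norm_sin.
  by rewrite mul1r -normrM mulVKf// pnatr_eq0.
- exact/intble_norm/sqintble_intble.
- move=> x; rewrite mulrC.
  under eq_fun do rewrite mulrCA.
  by apply: cvgM; [exact: cvg_cst|exact: scaled_sin_cvg].
- move=> n; rewrite meanZ; first by rewrite sin_cos0 mulr0.
  apply: (@intble_le _ _ _ _ _ (fun=> 1)); last exact: intble_cst.
    exact: measurable_funM.
  move=> x; rewrite normrM mulr_ile1// ler_norml ?cos_geN1 ?cos_le1//.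
  by rewrite sin_geN1 sin_le1.
Qed.

End gaussian_uncorrelated.

(** * Adapted processes *)
Section measurable_matrices.
Context d (S : measurableType d) (K : realType).

Lemma measurable_mx_entry m n (i : 'I_m) (j : 'I_n) :
  measurable_fun setT (fun M : 'M[K]_(m, n) => M i j).
Proof.
move=> _ E mE; rewrite setTI; apply: sub_sigma_algebra.
by exists i, j; exists E.
Qed.

Lemma measurable_mxP m n (f : S -> 'M[K]_(m, n)) :
  (forall i j, measurable_fun setT (fun x => f x i j)) -> measurable_fun setT f.
Proof.
move=> mf; apply: (@measurability _ _ _ _ _ _ (@matrix_cylinders _ K m n)) => //.
move=> _ [_ [i [j [E mE ->]] <-]]; exact: mf.
Qed.

Lemma measurable_mx_coord m n (f : S -> 'M[K]_(m, n)) i j :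
  measurable_fun setT f -> measurable_fun setT (fun x => f x i j).
Proof. by move=> mf; exact: measurableT_comp (measurable_mx_entry i j) mf. Qed.

Lemma measurable_mxD m n (f g : S -> 'M[K]_(m, n)) :
  measurable_fun setT f -> measurable_fun setT g ->
  measurable_fun setT (fun x => f x + g x).
Proof.
move=> mf mg; apply: measurable_mxP => i j; under eq_fun do rewrite mxE.
by apply: measurable_funD; exact: measurable_mx_coord.
Qed.

Lemma measurable_mulmx m n p (M : 'M[K]_(m, n)) (f : S -> 'M[K]_(n, p)) :
  measurable_fun setT f -> measurable_fun setT (fun x => M *m f x).
Proof.
move=> mf; apply: measurable_mxP => i j; under eq_fun do rewrite mxE.
apply: measurable_sum => k; apply: measurable_funM => //.
exact: measurable_mx_coord.
Qed.

Lemma measurable_usubmx m1 m2 n (f : S -> 'M[K]_(m1 + m2, n)) :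
  measurable_fun setT f -> measurable_fun setT (fun x => usubmx (f x)).
Proof.
move=> mf; apply: measurable_mxP => i j; under eq_fun do rewrite mxE.
exact: measurable_mx_coord.
Qed.

Lemma measurable_dsubmx m1 m2 n (f : S -> 'M[K]_(m1 + m2, n)) :
  measurable_fun setT f -> measurable_fun setT (fun x => dsubmx (f x)).
Proof.
move=> mf; apply: measurable_mxP => i j; under eq_fun do rewrite mxE.
exact: measurable_mx_coord.
Qed.

Lemma measurable_col_mx m1 m2 n (f : S -> 'M[K]_(m1, n)) (g : S -> 'M[K]_(m2, n)) :
  measurable_fun setT f -> measurable_fun setT g ->
  measurable_fun setT (fun x => col_mx (f x) (g x)).
Proof.
move=> mf mg; apply: measurable_mxP => i j.
under eq_fun do rewrite mxE; case: (fintype.split i) => k; exact: measurable_mx_coord.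
Qed.

End measurable_matrices.

Section past.
Context d (T : measurableType d) (K : realType) (k : nat).
Variable z : nat -> T -> 'cV[K]_k.
Hypothesis mz : forall r, measurable_fun setT (z r).

(** A pi-system generating the sigma-algebra of [z(0), ..., z(t - 1)]. *)
Definition past (t : nat) : set (set T) :=
  [set C | exists2 E : nat -> set 'cV[K]_k, forall r, measurable (E r) &
     C = \bigcap_(r in `I_t) (z r @^-1` E r)].

Lemma past_setI t : setI_closed (past t).
Proof.
move=> _ _ [E mE ->] [F mF ->]; exists (fun r => E r `&` F r).
  by move=> r; exact: measurableI.
by rewrite -bigcapI.
Qed.

Lemma past_measurable t : past t `<=` measurable.
Proof.
move=> _ [E mE ->]; apply: bigcap_measurableType => r _.
by rewrite -[X in measurable X]setTI; exact: mz.
Qed.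

Lemma past_setT t : past t setT.
Proof.
by exists (fun=> setT) => //; apply/seteqP; split.
Qed.

Lemma past_sub t t' : (t <= t')%N -> past t `<=` past t'.
Proof.
move=> tt' _ [E mE ->]; exists (fun r => if (r < t)%N then E r else setT).
  by move=> r; case: ifP.
apply/seteqP; split => x Ex r /= rt; last first.
  by have := Ex r (leq_trans rt tt'); rewrite /= rt.
by case: ifP => // rt'; exact: Ex.
Qed.

(** Measurability with respect to strictly earlier values: in this indexing
the state at time [t] is adapted to the noise at time [t]. *)
Definition adapted d' (S : measurableType d') t (f : T -> S) :=
  measurable_fun setT (f : g_sigma_algebraType (past t) -> S).

Lemma adapted_measurable d' (S : measurableType d') t (f : T -> S) :
  adapted t f -> measurable_fun setT f.
Proof.
move=> mf _ E mE; have := mf measurableT E mE.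
by apply: smallest_sub (@past_measurable t) _; exact: sigma_algebra_measurable.
Qed.

Lemma adapted_le d' (S : measurableType d') t t' (f : T -> S) : (t <= t')%N ->
  adapted t f -> adapted t' f.
Proof.
move=> tt' mf _ E mE; have := mf measurableT E mE.
have sub : past t `<=` <<s past t' >>.
  by move=> C /(past_sub tt') tC; exact: sub_sigma_algebra.
exact: (smallest_sub (smallest_sigma_algebra _ _) sub).
Qed.

Lemma adapted_past t r : (r < t)%N -> adapted t (z r).
Proof.
move=> rt _ E mE; rewrite setTI; apply: sub_sigma_algebra.
exists (fun r' => if r' == r then E else setT) => [r'|]; first by case: ifP.
apply/seteqP; split => [x Ex r' _ /=|x /(_ r rt)/=]; last by rewrite eqxx.
by case: ifP => [/eqP ->|].
Qed.

End past.

(** * Independence in time *)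
Section independence.
Context d (T : measurableType d) (K : realType) (P : probability T K) (n : nat).
Variable w : nat -> T -> 'cV[K]_n.
Hypothesis mw : forall t, measurable_fun setT (w t).
Hypothesis indw : mutually_independent P w.
Local Notation mean := (mean P).

Lemma mean_indic (C : set T) : measurable C -> mean \1_C = fine (P C).
Proof. by move=> mC; congr fine; rewrite integral_indic// setIT. Qed.

Let mpre t (E : set 'cV[K]_n) : measurable E -> measurable (w t @^-1` E).
Proof. by move=> mE; rewrite -[X in measurable X]setTI; exact: mw. Qed.

(** [orthogonal_sigma_algebra] with the roles exchanged: the centred indicator
of [C] has mean zero on all the events of [w s], hence is orthogonal to
[psi (w s)]. *)
Lemma independent_factor s (l : seq nat) (E : nat -> set 'cV[K]_n)
    (psi : 'cV[K]_n -> K) :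
  uniq l -> s \notin l -> (forall r, measurable (E r)) ->
  measurable_fun setT psi -> sqintble P (fun x => psi (w s x)) ->
  let C := \bigcap_(r in [set` l]) (w r @^-1` E r) in
  mean (fun x => psi (w s x) * \1_C x) = mean (fun x => psi (w s x)) * fine (P C).
Proof.
move=> ul sl mE mpsi psi2 C.
have mC : measurable C by apply: bigcap_measurableType => r _; exact: mpre.
pose p := fine (P C).
have ind1 (D : set T) x : `|\1_D x : K| <= 1.
  by rewrite indicE; case: (_ \in _); rewrite ?normr1 ?normr0.
have C2 : sqintble P \1_C by apply: (@sqintble_bounded _ _ _ _ _ 1).
have V2 : sqintble P (fun x => \1_C x - p).
  by apply: sqintbleB => //; exact: sqintble_cst.
pose G := [set D | exists2 F, measurable F & D = w s @^-1` F].
have GI : setI_closed G.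
  move=> _ _ [F mF ->] [F' mF' ->]; exists (F `&` F') => //; exact: measurableI.
have Gm : G `<=` measurable by move=> _ [F mF ->]; exact: mpre.
have GT : G setT by exists setT.
have VG D : G D -> mean (fun x => (\1_C x - p) * \1_D x) = 0.
  move=> [F mF ->]; have mD := mpre s mF; set D' := w s @^-1` F.
  have -> : (fun x => (\1_C x - p) * \1_D' x) =
      (fun x => \1_(D' `&` C) x - p * \1_D' x).
    by apply/funext => x; rewrite mulrBl indicI/= mulrC.
  have D'i : intble P \1_D' by apply/sqintble_intble/(@sqintble_bounded _ _ _ _ _ 1).
  have DCi : intble P \1_(D' `&` C).
    apply/sqintble_intble/(@sqintble_bounded _ _ _ _ _ 1) => //.
    by apply: measurable_indic; exact: measurableI.
  rewrite meanB//; last exact: intbleZ.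
  rewrite meanZ// !mean_indic//; last exact: measurableI.
  have := @indw (s :: l) (fun r => if r == s then F else E r).
  rewrite /= sl ul => /(_ erefl) h.
  have -> : P (D' `&` C) = (P D' * P C)%E.
    have := @indw l E ul mE; rewrite -/C => PC.
    rewrite PC; have := h _; rewrite big_cons eqxx.
    rewrite (_ : \bigcap_(_ in _) _ = D' `&` C); last first.
      rewrite /C; apply/seteqP; split => x.
        move=> Ex; split; first by have := Ex s; rewrite /= inE eqxx; exact.
        move=> r /= rl; have := Ex r; rewrite /= inE rl orbT => /(_ isT).
        by case: eqP => // rs; rewrite -rs rl in sl.
      move=> [Dx Cx] r; rewrite /= inE => /orP[/eqP ->|rl]; first by rewrite eqxx.
      by case: eqP => [rs|_]; [rewrite rs|exact: Cx].
    move=> -> //; last by move=> r; case: ifP.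
    congr (_ * _)%E; apply: eq_big_seq => r rl.
    by case: eqP => // rs; rewrite -rs rl in sl.
  by rewrite fineM ?fin_num_measure// mulrC subrr.
have mpsiG : measurable_fun setT ((fun x => psi (w s x)) : g_sigma_algebraType G -> K).
  move=> _ E' mE'; rewrite setTI; apply: sub_sigma_algebra.
  exists (psi @^-1` E') => //; rewrite -[X in measurable X]setTI; exact: mpsi.
have := orthogonal_sigma_algebra GI Gm GT V2 VG mpsiG psi2.
have -> : (fun x => (\1_C x - p) * psi (w s x)) =
    (fun x => psi (w s x) * \1_C x - p * psi (w s x)).
  by apply/funext => x; rewrite mulrBl mulrC.
rewrite meanB; [|exact: sqintbleM|exact/intbleZ/sqintble_intble].
rewrite meanZ; last exact: sqintble_intble.
by move=> /eqP; rewrite subr_eq0 => /eqP ->; rewrite mulrC.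
Qed.

(** Independence reduces the whole history to the single time [s]: the other
factors of the event split off, and what is left is the hypothesis at time
[s]. *)
Lemma independent_past_null k (h : 'cV[K]_n -> 'cV[K]_k) s (psi : 'cV[K]_n -> K) :
  measurable_fun setT h -> measurable_fun setT psi ->
  sqintble P (fun x => psi (w s x)) -> mean (fun x => psi (w s x)) = 0 ->
  forall t, ((s < t)%N -> forall E : set 'cV[K]_k, measurable E ->
    mean (fun x => psi (w s x) * \1_((h \o w s) @^-1` E) x) = 0) ->
  forall C, past (fun r => h \o w r) t C ->
  mean (fun x => psi (w s x) * \1_C x) = 0.
Proof.
move=> mh mpsi psi2 Epsi t null _ [E mE ->].
(* the times of the event other than [s]; time [s] itself may or may not occur *)
pose l := [seq r <- iota 0 t | r != s].
pose F := if (s < t)%N then h @^-1` E s else setT.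
have mhE r : measurable (h @^-1` E r).
  by rewrite -[X in measurable X]setTI; exact: mh.
have mF : measurable F by rewrite /F; case: ifP.
set C := \bigcap_(r in `I_t) _.
have CE : C = w s @^-1` F `&` \bigcap_(r in [set` l]) (w r @^-1` (h @^-1` E r)).
  apply/seteqP; split => x.
    move=> Cx; split; first by rewrite /F /=; case: ifP => // st; exact: Cx.
    by move=> r; rewrite /= mem_filter mem_iota => /andP[_]; exact: Cx.
  move=> [Fx Cx] r /= rt; have [rs|rs] := eqVneq r s.
    by move: Fx; rewrite /F /= -rs rt.
  by apply: Cx; rewrite /= mem_filter mem_iota rs.
have mpsiF : measurable_fun setT (fun v => psi v * \1_F v) by exact: measurable_funM.
have psiF2 : sqintble P (fun x => psi (w s x) * \1_F (w s x)).
  apply: (@sqintbleMbounded _ _ _ _ _ _ 1) => //.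
    have mind : measurable_fun setT (\1_F : 'cV[K]_n -> K) by exact: measurable_indic.
    exact: measurableT_comp mind (mw s).
  by move=> x; rewrite indicE; case: (_ \in _); rewrite ?normr1 ?normr0.
have ul : uniq l by rewrite filter_uniq// iota_uniq.
have sl : s \notin l by rewrite mem_filter eqxx.
have /= := independent_factor ul sl (E := fun r => h @^-1` E r) mhE mpsiF psiF2.
rewrite [X in mean X * _](_ : _ = fun x => psi (w s x) * \1_(w s @^-1` F) x); last first.
  by apply/funext => x; rewrite !indicE.
have -> : mean (fun x => psi (w s x) * \1_(w s @^-1` F) x) = 0.
  rewrite /F; case: ifP => st; first exact: null.
  by under eq_fun do rewrite indicE in_setT mulr1.
rewrite mul0r => <-; congr mean; apply/funext => x.
by rewrite CE indicI /= mulrA !indicE.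
Qed.

End independence.

(** * Orthogonality of the noise *)
Section square_integrable_vectors.
Context d (T : measurableType d) (K : realType) (P : probability T K).

Definition sqvec n (f : T -> 'cV[K]_n) := forall i, sqintble P (fun x => f x i 0).

Lemma sqvecD n (f g : T -> 'cV[K]_n) : sqvec f -> sqvec g ->
  sqvec (fun x => f x + g x).
Proof. by move=> f2 g2 i; under eq_fun do rewrite mxE; exact: sqintbleD. Qed.

Lemma sqvecN n (f : T -> 'cV[K]_n) : sqvec f -> sqvec (fun x => - f x).
Proof. by move=> f2 i; under eq_fun do rewrite mxE; exact: sqintbleN. Qed.

Lemma sqvecB n (f g : T -> 'cV[K]_n) : sqvec f -> sqvec g ->
  sqvec (fun x => f x - g x).
Proof. by move=> f2 g2; apply: sqvecD => //; exact: sqvecN. Qed.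

Lemma sqvec0 n : sqvec (fun=> 0 : 'cV[K]_n).
Proof. by move=> i; under eq_fun do rewrite mxE; exact: sqintble_cst. Qed.

Lemma sqvec_mul m n (M : 'M[K]_(m, n)) (f : T -> 'cV[K]_n) : sqvec f ->
  sqvec (fun x => M *m f x).
Proof.
move=> f2 i; under eq_fun do rewrite mxE.
by apply: sqintble_sum => j; exact: sqintbleZ.
Qed.

Lemma sqvec_usubmx m n (f : T -> 'cV[K]_(m + n)) : sqvec f ->
  sqvec (fun x => usubmx (f x)).
Proof. by move=> f2 i; under eq_fun do rewrite mxE; exact: f2. Qed.

Lemma sqvec_dsubmx m n (f : T -> 'cV[K]_(m + n)) : sqvec f ->
  sqvec (fun x => dsubmx (f x)).
Proof. by move=> f2 i; under eq_fun do rewrite mxE; exact: f2. Qed.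

Lemma sqvec_col_mx m n (f : T -> 'cV[K]_m) (g : T -> 'cV[K]_n) : sqvec f ->
  sqvec g -> sqvec (fun x => col_mx (f x) (g x)).
Proof.
move=> f2 g2 i; under eq_fun do rewrite mxE.
by case: (fintype.split i) => k; [exact: f2|exact: g2].
Qed.

Lemma intble_dot n (f g : T -> 'cV[K]_n) : sqvec f -> sqvec g ->
  intble P (fun x => dot (f x) (g x)).
Proof.
move=> f2 g2; under eq_fun do rewrite dotE.
by apply: intble_sum => i _; exact: sqintbleM.
Qed.

Lemma mean_dot n (f g : T -> 'cV[K]_n) : sqvec f -> sqvec g ->
  mean P (fun x => dot (f x) (g x)) = \sum_i mean P (fun x => f x i 0 * g x i 0).
Proof.
move=> f2 g2; under eq_fun do rewrite dotE.
by rewrite mean_sum// => i; exact: sqintbleM.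
Qed.

Lemma intble_sqnorm n (f : T -> 'cV[K]_n) : sqvec f ->
  intble P (fun x => sqnorm (f x)).
Proof. by move=> f2; apply: intble_sum => i _; case: (f2 i). Qed.

Lemma sqvec_sqnorm_le n (f : T -> 'cV[K]_n) (c : T -> K) :
  measurable_fun setT f -> intble P c -> (forall x, sqnorm (f x) <= c x) ->
  sqvec f.
Proof.
move=> mf ci fc i; have mfi := measurable_mx_coord i 0 mf; split=> //.
apply: intble_le ci; first exact: measurable_funX.
move=> x; rewrite ger0_norm ?sqr_ge0// (le_trans _ (fc x))//.
rewrite /sqnorm (bigD1 i)//= lerDl sumr_ge0// => j _; exact: sqr_ge0.
Qed.

Definition orthogonal_to n (f : T -> 'cV[K]_n) (phi : T -> K) :=
  forall i, mean P (fun x => f x i 0 * phi x) = 0.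

Lemma orthogonal_to_mul m n (M : 'M[K]_(m, n)) f phi : sqvec f ->
  sqintble P phi -> orthogonal_to f phi -> orthogonal_to (fun x => M *m f x) phi.
Proof.
move=> f2 phi2 fphi i.
under eq_fun do rewrite mxE mulr_suml.
rewrite mean_sum => [|j].
  rewrite big1// => j _; under [X in mean P X]eq_fun do rewrite -mulrA.
  by rewrite (meanZ _ (sqintbleM (f2 j) phi2)) fphi mulr0.
by under eq_fun do rewrite -mulrA; exact/intbleZ/sqintbleM.
Qed.

Lemma orthogonal_toD n (f g : T -> 'cV[K]_n) phi : sqvec f -> sqvec g ->
  sqintble P phi -> orthogonal_to f phi -> orthogonal_to g phi ->
  orthogonal_to (fun x => f x + g x) phi.
Proof.
move=> f2 g2 phi2 fphi gphi i; under eq_fun do rewrite mxE mulrDl.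
rewrite (meanD (sqintbleM (f2 i) phi2) (sqintbleM (g2 i) phi2)).
by rewrite fphi gphi addr0.
Qed.

Lemma orthogonal_to0 n phi : orthogonal_to (fun=> 0 : 'cV[K]_n) phi.
Proof. by move=> i; under eq_fun do rewrite mxE mul0r; rewrite mean_cst. Qed.

Lemma orthogonal_to_col_mx m n (f : T -> 'cV[K]_m) (g : T -> 'cV[K]_n) phi :
  orthogonal_to f phi -> orthogonal_to g phi ->
  orthogonal_to (fun x => col_mx (f x) (g x)) phi.
Proof.
move=> fphi gphi i; under eq_fun do rewrite mxE.
by case: (fintype.split i) => k; [exact: fphi|exact: gphi].
Qed.

Lemma orthogonal_dot n (f g : T -> 'cV[K]_n) : sqvec f -> sqvec g ->
  (forall i, orthogonal_to f (fun x => g x i 0)) ->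
  mean P (fun x => dot (f x) (g x)) = 0.
Proof. by move=> f2 g2 fg; rewrite mean_dot// big1// => i _; exact: fg. Qed.

End square_integrable_vectors.

Section white_noise.
Context d (T : measurableType d) (K : realType) (P : probability T K).
Context {n1 n2 : nat} (W1 : 'M[K]_n1) (W2 : 'M[K]_n2).
Variable w : nat -> {RV P >-> 'cV[K]_(n1 + n2)}.
Hypothesis white : gaussian_white_noise (block_mx W1 0 0 W2) w.

Lemma noise_measurable t : measurable_fun setT (w t).
Proof. exact: measurable_funPT. Qed.

Lemma noise_sqvec t : sqvec P (w t).
Proof.
have [_ _ _ cov] := white; move=> i.
have mwi := measurable_mx_coord i 0 (noise_measurable t).
split=> //; have := cov t t i i; rewrite unlock => covii.
apply/integrableP; split; first by apply/measurable_EFinP; exact: measurable_funX.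
under eq_integral do rewrite /= ger0_norm ?sqr_ge0// expr2.
by rewrite covii ltry.
Qed.

Lemma noise_mean t i : mean P (fun x => w t x i 0) = 0.
Proof.
have [_ _ Ew _] := white; have := Ew t i; rewrite unlock.
by rewrite mean_fin => [[]|]//; exact/sqintble_intble/noise_sqvec.
Qed.

Lemma noise_cov k l i j :
  mean P (fun x => w k x i 0 * w l x j 0) = (block_mx W1 0 0 W2 *+ (k == l)) i j.
Proof.
have [_ _ _ cov] := white; have := cov k l i j; rewrite unlock.
by rewrite mean_fin => [[]|]//; apply: sqintbleM; exact: noise_sqvec.
Qed.

(** The step that uses normality: uncorrelated blocks of a normal vector are
independent, here in the form that [w2(t)] has mean zero on every event of
[w1(t)]. *)
Lemma noise2_null t j (E : set 'cV[K]_n1) : measurable E ->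
  mean P (fun x => dsubmx (w t x) j 0 * \1_((usubmx \o w t) @^-1` E) x) = 0.
Proof.
move=> mE; have [_ gauss _ _] := white.
pose xi (i : 'I_n1) x := usubmx (w t x) i 0.
pose eta x := dsubmx (w t x) j 0.
pose s := [seq xi i | i <- enum 'I_n1].
have u2 : sqvec P (fun x => usubmx (w t x)) by apply: sqvec_usubmx; exact: noise_sqvec.
have eta2 : sqintble P eta by exact: (sqvec_dsubmx (noise_sqvec t)).
have xi_in i : List.In (xi i) s.
  rewrite /s; have : i \in enum 'I_n1 by rewrite mem_enum.
  elim: (enum _) => //= a l IH; rewrite inE => /orP[/eqP ->|/IH]; by [left|right].
have in_xi f : List.In f s -> exists i, f = xi i.
  by rewrite /s; elim: (enum _) => //= a l IH [<-|//]; exists a.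
have ms f : List.In f s -> measurable_fun setT f.
  move=> /in_xi[i ->]; exact: (u2 i).1.
have span f : affine_span s f ->
    exists a b, f = fun x => dot a (usubmx (w t x)) + b.
  rewrite /s; elim: (enum _) f => [f [b ->]|i l IH f [c [g /IH[a [b ->]] ->]]].
    by exists 0, b; apply/funext => x; rewrite dot0l add0r.
  exists (c *: delta_mx i 0 + a), b; apply/funext => x.
  rewrite dotDl dotZl addrA; congr (c * _ + _ + _).
  by rewrite /dot trmx_delta -rowE mxE.
have eta_cos f : affine_span s f -> mean P (fun x => eta x * cos (f x)) = 0.
  move=> /span[a [b ->]].
  have th2 : sqintble P (fun x => dot a (usubmx (w t x))).
    under eq_fun do rewrite dotE.
    by apply: sqintble_sum => i; exact: sqintbleZ.
  have Exi i : mean P (xi i) = 0.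
    by rewrite /xi; under eq_fun do rewrite mxE; exact: noise_mean.
  apply: gaussian_uncorrelated_null => //.
  - under eq_fun do rewrite dotE.
    rewrite mean_sum => [|i]; last exact/intbleZ/sqintble_intble.
    by rewrite big1// => i _; rewrite meanZ ?Exi ?mulr0//; exact: sqintble_intble.
  - by rewrite /eta; under eq_fun do rewrite mxE; exact: noise_mean.
  - under eq_fun do rewrite dotE mulr_suml.
    rewrite mean_sum => [|i].
      rewrite big1// => i _; under [X in mean P X]eq_fun do rewrite -mulrA.
      rewrite (meanZ _ (sqintbleM (u2 i) eta2)).
      rewrite (_ : mean P _ = 0) ?mulr0// /eta.
      under eq_fun do rewrite !mxE.
      by rewrite noise_cov eqxx mulr1n block_mxEur mxE.
    by under eq_fun do rewrite -mulrA; exact/intbleZ/sqintbleM.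
  - move=> c; have := gauss t (col_mx a (c *: delta_mx j 0)).
    congr gaussian_rv; apply/funext => x.
    rewrite -{1}[w t x]vsubmxK -/(dot _ _) dot_col_mx dotZl; congr (_ + c * _).
    by rewrite /dot trmx_delta -rowE mxE.
have null := fourier_null_orthant (sqintble_intble eta2) ms eta_cos.
have mE' : measurable ((usubmx \o w t) @^-1` E).
  rewrite -[X in measurable X]setTI.
  by apply: (measurable_usubmx (noise_measurable t)).
apply: (orthogonal_sigma_algebra (orthant_setI (s := s)) (orthant_measurable ms)
  (orthant_setT s) eta2 null); last first.
  apply: (@sqintble_bounded _ _ _ _ _ 1) => // x.
  by rewrite indicE; case: (_ \in _); rewrite ?normr1 ?normr0.
apply: measurable_indic.
have mu : measurable_fun setT
    ((fun x => usubmx (w t x)) : g_sigma_algebraType (orthant s) -> 'cV[K]_n1).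
  apply: measurable_mxP => i k; rewrite (ord1 k).
  exact: orthant_measurable_fun (xi_in i).
by have := mu measurableT E mE; rewrite setTI.
Qed.

Lemma noise_orthogonal_past t phi : adapted (fun r => w r : T -> _) t phi ->
  sqintble P phi -> orthogonal_to P (w t) phi.
Proof.
move=> aphi phi2 i; have [indw _ _ _] := white.
apply: (orthogonal_sigma_algebra (@past_setI _ _ _ _ _ _)
  (@past_measurable _ _ _ _ _ noise_measurable t) (past_setT _ t) (noise_sqvec t i)
  _ aphi phi2) => C pC.
apply: (@independent_past_null _ _ _ P _ (fun r => w r : T -> _) noise_measurable indw
  _ id t (fun v => v i 0) _ _ (noise_sqvec t i) (noise_mean t i) t) => //.
  exact: measurable_mx_entry.
by rewrite ltnn.
Qed.

(** [s] and [t] are unrelated: [w2(s)] is orthogonal to the functions of [w1] in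
the past, in the present and in the future. *)
Lemma noise2_orthogonal_noise1 s t phi : adapted (fun r => usubmx \o w r) t phi ->
  sqintble P phi -> orthogonal_to P (fun x => dsubmx (w s x)) phi.
Proof.
move=> aphi phi2 i; have [indw _ _ _] := white.
have mu r : measurable_fun setT (usubmx \o w r).
  exact: measurable_usubmx (noise_measurable r).
have d2 := sqvec_dsubmx (noise_sqvec s) i.
apply: (orthogonal_sigma_algebra (@past_setI _ _ _ _ _ _)
  (@past_measurable _ _ _ _ _ mu t) (past_setT _ t) d2 _ aphi phi2) => C pC.
have Ed : mean P (fun x => dsubmx (w s x) i 0) = 0.
  by under eq_fun do rewrite mxE; exact: noise_mean.
apply: (@independent_past_null _ _ _ P _ (fun r => w r : T -> _) noise_measurable indw
  _ usubmx s (fun v => dsubmx v i 0) _ _ d2 Ed t) => //.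
- by apply: measurable_mxP => j k; under eq_fun do rewrite mxE; exact: measurable_mx_entry.
- by under eq_fun do rewrite mxE; exact: measurable_mx_entry.
- by move=> _ E mE; exact: noise2_null.
Qed.

End white_noise.

(** * The estimate and the residual as processes *)
Section adapted_vectors.
Context d (T : measurableType d) (K : realType) (k : nat).
Variable z : nat -> T -> 'cV[K]_k.

Lemma adapted_entry n t (f : T -> 'cV[K]_n) i :
  adapted z t f -> adapted z t (fun x => f x i 0).
Proof. by move=> af; exact: measurable_mx_coord. Qed.

End adapted_vectors.

Section noise_driven_processes.
Context d (T : measurableType d) (K : realType) (P : probability T K).
Context {n1 n2 : nat} (W1 : 'M[K]_n1) (W2 : 'M[K]_n2).
Variable w : nat -> {RV P >-> 'cV[K]_(n1 + n2)}.
Hypothesis white : gaussian_white_noise (block_mx W1 0 0 W2) w.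

Let wf (r : nat) : T -> 'cV[K]_(n1 + n2) := w r.
Let w1 (r : nat) : T -> 'cV[K]_n1 := usubmx \o w r.
Let v (r : nat) (x : T) : 'cV[K]_(n1 + n2) := col_mx (usubmx (w r x)) 0.

Lemma past_noise1_sub t C : past w1 t C -> past wf t C.
Proof.
move=> [E mE ->]; exists (fun r => usubmx @^-1` E r) => // r.
rewrite -[X in measurable X]setTI; apply: (@measurable_usubmx _ _ _ _ _ _ id) => //.
Qed.

Lemma noise1_adapted_sub d' (S : measurableType d') t (f : T -> S) :
  adapted w1 t f -> adapted wf t f.
Proof.
move=> af _ E mE; have := af measurableT E mE.
have sub : past w1 t `<=` <<s past wf t >>.
  by move=> C /past_noise1_sub tC; exact: sub_sigma_algebra.
exact: (smallest_sub (smallest_sigma_algebra _ _) sub).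
Qed.

Variables (F1 : 'M[K]_(n1 + n2)) (F2 : 'M[K]_n2).
Variables (xh : nat -> T -> 'cV[K]_(n1 + n2)) (xt : nat -> T -> 'cV[K]_n2).
Hypothesis xh0 : forall om, xh 0%N om = 0.
Hypothesis xt0 : forall om, xt 0%N om = 0.
Hypothesis xhS : forall t om, xh t.+1 om = F1 *m xh t om + v t om.
Hypothesis xtS : forall t om, xt t.+1 om = F2 *m xt t om + dsubmx (w t om).

Lemma estimate_adapted_noise1 t : adapted w1 t (xh t).
Proof.
elim: t => [|t IH].
  by rewrite (_ : xh 0%N = fun=> 0); [exact: measurable_cst|exact/funext].
rewrite (_ : xh t.+1 = fun x => F1 *m xh t x + v t x); last exact/funext.
apply: measurable_mxD; first by apply: measurable_mulmx; exact: adapted_le IH.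
apply: measurable_col_mx => //.
exact: (@adapted_past _ _ _ _ w1 t.+1 t).
Qed.

Lemma estimate_adapted t : adapted wf t (xh t).
Proof. by apply: noise1_adapted_sub; exact: estimate_adapted_noise1. Qed.

Lemma residual_adapted t : adapted wf t (xt t).
Proof.
elim: t => [|t IH].
  by rewrite (_ : xt 0%N = fun=> 0); [exact: measurable_cst|exact/funext].
rewrite (_ : xt t.+1 = fun x => F2 *m xt t x + dsubmx (w t x)); last exact/funext.
apply: measurable_mxD; first by apply: measurable_mulmx; exact: adapted_le IH.
apply: measurable_dsubmx.
exact: (@adapted_past _ _ _ _ wf t.+1 t).
Qed.

Lemma noise1_sqvec t : sqvec P (v t).
Proof.
by apply: sqvec_col_mx; [apply: sqvec_usubmx; exact: noise_sqvec white t|exact: sqvec0].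
Qed.

Lemma estimate_sqvec t : sqvec P (xh t).
Proof.
elim: t => [|t IH].
  by rewrite (_ : xh 0%N = fun=> 0); [exact: sqvec0|exact/funext].
rewrite (_ : xh t.+1 = fun x => F1 *m xh t x + v t x); last exact/funext.
by apply: sqvecD; [exact: sqvec_mul|exact: noise1_sqvec].
Qed.

Lemma noise2_sqvec t : sqvec P (fun x => dsubmx (w t x)).
Proof. exact/sqvec_dsubmx/(noise_sqvec white). Qed.

Lemma residual_sqvec t : sqvec P (xt t).
Proof.
elim: t => [|t IH].
  by rewrite (_ : xt 0%N = fun=> 0); [exact: sqvec0|exact/funext].
rewrite (_ : xt t.+1 = fun x => F2 *m xt t x + dsubmx (w t x)); last exact/funext.
by apply: sqvecD; [exact: sqvec_mul|exact: noise2_sqvec].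
Qed.

(** The residual is a linear combination of the [w2(s)]. *)
Lemma residual_orthogonal_noise1 s t phi : adapted w1 s phi -> sqintble P phi ->
  orthogonal_to P (xt t) phi.
Proof.
move=> aphi phi2; elim: t => [|t IH].
  by rewrite (_ : xt 0%N = fun=> 0); [exact: orthogonal_to0|exact/funext].
rewrite (_ : xt t.+1 = fun x => F2 *m xt t x + dsubmx (w t x)); last exact/funext.
apply: orthogonal_toD => //.
- exact/sqvec_mul/residual_sqvec.
- exact: noise2_sqvec.
- by apply: orthogonal_to_mul => //; exact: residual_sqvec.
- exact (noise2_orthogonal_noise1 white t aphi phi2).
Qed.

Lemma noise1_orthogonal_past t phi : adapted wf t phi -> sqintble P phi ->
  orthogonal_to P (v t) phi.
Proof.
move=> aphi phi2; apply: orthogonal_to_col_mx; last exact: orthogonal_to0.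
move=> i; under eq_fun do rewrite mxE.
exact: (noise_orthogonal_past white aphi phi2).
Qed.

Lemma noise2_orthogonal_past t phi : adapted wf t phi -> sqintble P phi ->
  orthogonal_to P (fun x => dsubmx (w t x)) phi.
Proof.
move=> aphi phi2 i; under eq_fun do rewrite mxE.
exact: (noise_orthogonal_past white aphi phi2).
Qed.

Lemma mean_quad_cov n (M : 'M[K]_n) (f : T -> 'cV[K]_n) (Wf : 'M[K]_n) : sqvec P f ->
  (forall i j, mean P (fun x => f x i 0 * f x j 0) = Wf i j) ->
  mean P (fun x => dot (f x) (M *m f x)) = \tr (M *m Wf).
Proof.
move=> f2 cov; rewrite mean_dot//; last exact: sqvec_mul.
rewrite /mxtrace; apply: eq_bigr => i _; rewrite mxE.
under eq_fun do rewrite mxE mulr_sumr.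
rewrite mean_sum => [|j].
  apply: eq_bigr => j _; rewrite -cov.
  under eq_fun do rewrite mulrCA.
  rewrite (meanZ _ (sqintbleM (f2 i) (f2 j))); congr (_ * mean P _).
  by apply/funext => x; rewrite mulrC.
by under eq_fun do rewrite mulrCA; apply: intbleZ; exact: sqintbleM.
Qed.

Lemma noise1_cov t i j : mean P (fun x => v t x i 0 * v t x j 0) = (block_mx W1 0 0 0) i j.
Proof.
rewrite /v; case: (split_ordP i) => k ->; case: (split_ordP j) => l ->;
  under eq_fun do rewrite ?col_mxEu ?col_mxEd.
- under eq_fun do rewrite !mxE.
  by rewrite (noise_cov white) eqxx mulr1n !block_mxEul.
- under eq_fun do rewrite mxE [X in _ * X]mxE mulr0.
  by rewrite mean_cst block_mxEur mxE.
- under eq_fun do rewrite mxE mul0r.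
  by rewrite mean_cst block_mxEdl mxE.
- under eq_fun do rewrite mxE mul0r.
  by rewrite mean_cst block_mxEdr mxE.
Qed.

Lemma noise2_cov t i j :
  mean P (fun x => dsubmx (w t x) i 0 * dsubmx (w t x) j 0) = W2 i j.
Proof.
under eq_fun do rewrite !mxE.
by rewrite (noise_cov white) eqxx mulr1n block_mxEdr.
Qed.

Lemma mean_quad_step n (X F : 'M[K]_n) (f g : T -> 'cV[K]_n) :
  X^T = X -> sqvec P f -> sqvec P g ->
  (forall phi, sqintble P phi -> (exists M : 'rV[K]_n, phi = fun x => (M *m f x) 0 0) ->
     orthogonal_to P g phi) ->
  mean P (fun x => dot (F *m f x + g x) (X *m (F *m f x + g x))) =
  mean P (fun x => dot (F *m f x) (X *m (F *m f x))) +
  mean P (fun x => dot (g x) (X *m g x)).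
Proof.
move=> sX f2 g2 fg.
have Ff2 := sqvec_mul F f2; have XFf2 := sqvec_mul X Ff2; have Xg2 := sqvec_mul X g2.
have i1 := intble_dot Ff2 XFf2; have i2 := intble_dot g2 Xg2.
have i3 := intble_dot XFf2 g2.
have cross : mean P (fun x => dot (X *m (F *m f x)) (g x)) = 0.
  under eq_fun do rewrite dotC.
  apply: (@orthogonal_dot _ _ _ _ _ g (fun x => X *m (F *m f x))) => // i.
  apply: fg; first exact: XFf2.
  exists (row i (X *m F)); apply/funext => x.
  by rewrite -row_mul mulmxA [RHS]mxE.
under eq_fun do rewrite quadD//.
rewrite meanD; [|exact: intbleD|exact: intbleZ].
by rewrite meanD// (meanZ _ i3) cross mulr0 addr0.
Qed.

Lemma adapted_lin n m (M : 'rV[K]_n) t (f : T -> 'cV[K]_n) (z : nat -> T -> 'cV[K]_m) :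
  adapted z t f -> adapted z t (fun x => (M *m f x) 0 0).
Proof. by move=> af; apply: adapted_entry; exact: measurable_mulmx. Qed.

Lemma mean_estimate_step (X : 'M[K]_(n1 + n2)) t : X^T = X ->
  mean P (fun x => dot (xh t.+1 x) (X *m xh t.+1 x)) =
  mean P (fun x => dot (F1 *m xh t x) (X *m (F1 *m xh t x))) +
  \tr (ulsubmx X *m W1).
Proof.
move=> sX; rewrite (_ : xh t.+1 = fun x => F1 *m xh t x + v t x); last exact/funext.
rewrite mean_quad_step//; [|exact: estimate_sqvec|exact: noise1_sqvec|].
  congr (_ + _); rewrite (mean_quad_cov X (noise1_sqvec t) (noise1_cov t)).
  rewrite -[X in X *m _]submxK mulmx_block mxtrace_block.
  by rewrite !mulmx0 !addr0 mxtrace0 addr0.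
move=> phi phi2 [M phiE]; apply: noise1_orthogonal_past => //.
by rewrite phiE; apply: adapted_lin; exact: estimate_adapted.
Qed.

Lemma mean_residual_step (Y : 'M[K]_n2) t : Y^T = Y ->
  mean P (fun x => dot (xt t.+1 x) (Y *m xt t.+1 x)) =
  mean P (fun x => dot (F2 *m xt t x) (Y *m (F2 *m xt t x))) + \tr (Y *m W2).
Proof.
move=> sY; rewrite (_ : xt t.+1 = fun x => F2 *m xt t x + dsubmx (w t x)); last exact/funext.
rewrite mean_quad_step//; [|exact: residual_sqvec|exact: noise2_sqvec|].
  by rewrite (mean_quad_cov Y (noise2_sqvec t) (noise2_cov t)).
move=> phi phi2 [M phiE]; apply: noise2_orthogonal_past => //.
by rewrite phiE; apply: adapted_lin; exact: residual_adapted.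
Qed.

Lemma mean_sqnorm_noise t :
  mean P (fun x => sqnorm (w t x)) = \tr (block_mx W1 0 0 W2).
Proof.
rewrite /sqnorm mean_sum => [|i]; last by case: (noise_sqvec white t i).
apply: eq_bigr => i _; under eq_fun do rewrite expr2.
by rewrite (noise_cov white) eqxx mulr1n.
Qed.

Lemma stable_mean_bounded n (F : 'M[K]_n) (f g : nat -> T -> 'cV[K]_n) :
  schur_stable F -> (forall om, f 0%N om = 0) ->
  (forall t om, f t.+1 om = F *m f t om + g t om) ->
  (forall t, sqvec P (f t)) ->
  (forall t om, sqnorm (g t om) <= sqnorm (w t om)) ->
  exists c, forall N, mean P (fun x => sqnorm (f N x)) <= c.
Proof.
move=> sF f0 fS f2 gw.
have [c [a [a0 sa] bound]] := schur_stable_input_to_state sF.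
pose kap := \tr (block_mx W1 0 0 W2).
have kap0 : 0 <= kap.
  by rewrite /kap -(mean_sqnorm_noise 0); apply: mean_ge0 => x; exact: sqnorm_ge0.
have wi t : intble P (fun x => sqnorm (w t x)) by exact/intble_sqnorm/(noise_sqvec white).
exists (c * kap) => N.
apply: (@le_trans _ _ (mean P (fun x => \sum_(s < N) a (N.-1 - s)%N * sqnorm (w s x)))).
  apply: le_mean; first exact: intble_sqnorm.
    by apply: intble_sum => s _; exact: intbleZ.
  move=> x; apply: (le_trans (bound (f^~ x) (g^~ x) (f0 x) (fS^~ x) N)).
  by apply: ler_sum => s _; rewrite ler_wpM2l.
rewrite mean_sum => [|s]; last exact: intbleZ.
under eq_bigr do rewrite meanZ ?mean_sqnorm_noise//.
rewrite -mulr_suml ler_wpM2r// (le_trans _ (sa N))//.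
case: N => [|N]; first by rewrite !big_ord0.
rewrite (reindex_inj rev_ord_inj)/=; apply: ler_sum => s _.
by rewrite subSS subKn// -ltnS.
Qed.

Hypothesis sF1 : schur_stable F1.
Hypothesis sF2 : schur_stable F2.

Lemma estimate_bounded : exists c, forall N, mean P (fun x => sqnorm (xh N x)) <= c.
Proof.
apply: stable_mean_bounded sF1 xh0 xhS estimate_sqvec _ => t om.
rewrite /v -!dotvv -[w t om]vsubmxK !dot_col_mx col_mxKu dot0l addr0 lerDl dotvv.
exact: sqnorm_ge0.
Qed.

Lemma residual_bounded : exists c, forall N, mean P (fun x => sqnorm (xt N x)) <= c.
Proof.
apply: stable_mean_bounded sF2 xt0 xtS residual_sqvec _ => t om.
rewrite -!dotvv -[w t om]vsubmxK !dot_col_mx col_mxKd lerDr dotvv.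
exact: sqnorm_ge0.
Qed.

Lemma quad_bounded n (M : 'M[K]_n) (f : nat -> T -> 'cV[K]_n) :
  (forall t, sqvec P (f t)) ->
  (exists c, forall N, mean P (fun x => sqnorm (f N x)) <= c) ->
  exists c, forall N, mean P (fun x => dot (f N x) (M *m f N x)) <= c.
Proof.
move=> f2 [c fc]; pose k := 2^-1 * (1 + mxl1norm M ^+ 2 * n%:R).
have k0 : 0 <= k.
  rewrite mulr_ge0 ?invr_ge0// addr_ge0//.
  exact: mulr_ge0 (sqr_ge0 _) (ler0n _ _).
exists (k * c) => N; apply: le_trans (ler_wpM2l k0 (fc N)).
rewrite -meanZ; last exact: intble_sqnorm.
apply: le_mean; first by apply: intble_dot => //; exact: sqvec_mul.
  exact/intbleZ/intble_sqnorm.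
move=> x; have := sqnorm_mul M (f N x).
have := sqnorm_ge0 (f N x - M *m f N x).
rewrite -!dotvv !(dotDl, dotDr, dotNl, dotNr) (dotC (M *m _) (f N x)) /k.
by set a := dot _ _; set b := dot _ _; set e := dot _ _; lra.
Qed.

End noise_driven_processes.

(** * The two-player problem *)
Section two_player.
Context d (T : measurableType d) (K : realType) (P : probability T K).
Context {n1 n2 m1 m2 : nat}.
Variables (A11 : 'M[K]_n1) (A21 : 'M[K]_(n2, n1)) (A22 : 'M[K]_n2).
Variables (B1 : 'M[K]_(n1, m1)) (B2 : 'M[K]_(n2, m2)).
Variables (W1 : 'M[K]_n1) (W2 : 'M[K]_n2).
Variables (Q : 'M[K]_(n1 + n2)) (R : 'M[K]_(m1 + m2)).
Variables (X : 'M[K]_(n1 + n2)) (Y : 'M[K]_n2).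
Variable w : nat -> {RV P >-> 'cV[K]_(n1 + n2)}.

Let A : 'M[K]_(n1 + n2) := block_mx A11 0 A21 A22.
Let B : 'M[K]_(n1 + n2, m1 + m2) := block_mx B1 0 0 B2.
Let Q22 := drsubmx Q.
Let R22 := drsubmx R.
Let L1 := riccati_gain A B R X.
Let L2 := riccati_gain A22 B2 R22 Y.
Let F1 := A - B *m L1.
Let F2 := A22 - B2 *m L2.
Let J := \tr (ulsubmx X *m W1) + \tr (Y *m W2).

Let wf (r : nat) : T -> 'cV[K]_(n1 + n2) := w r.
Let w1 (r : nat) : T -> 'cV[K]_n1 := usubmx \o w r.

Hypothesis white : gaussian_white_noise (block_mx W1 0 0 W2) w.
Hypothesis psdQ : psd Q.
Hypothesis posR : posdef R.
Hypothesis solX : stabilizing_riccati_solution A B Q R X.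
Hypothesis solY : stabilizing_riccati_solution A22 B2 Q22 R22 Y.

Let symX : X^T = X. Proof. by have [/psd_sym] := solX. Qed.
Let symY : Y^T = Y. Proof. by have [/psd_sym] := solY. Qed.
Let stabX : schur_stable F1. Proof. by have [] := solX. Qed.
Let stabY : schur_stable F2. Proof. by have [] := solY. Qed.

Section optimal_process.
Variables (xh : nat -> T -> 'cV[K]_(n1 + n2)) (xt : nat -> T -> 'cV[K]_n2).
Hypothesis xh0 : forall om, xh 0%N om = 0.
Hypothesis xt0 : forall om, xt 0%N om = 0.
Hypothesis xhS : forall t om,
  xh t.+1 om = F1 *m xh t om + col_mx (usubmx (w t om)) 0.
Hypothesis xtS : forall t om, xt t.+1 om = F2 *m xt t om + dsubmx (w t om).

Let xo t om := opt_state (xh t om) (xt t om).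
Let uo t om := opt_input A11 A21 A22 B1 B2 R X Y (xh t om) (xt t om).
Let a N := mean P (fun om => dot (xh N om) (X *m xh N om)).
Let b N := mean P (fun om => dot (xt N om) (Y *m xt N om)).

Let xh2 t : sqvec P (xh t). Proof. exact: estimate_sqvec white _ _ xh0 xhS t. Qed.
Let xt2 t : sqvec P (xt t). Proof. exact: residual_sqvec white _ _ xt0 xtS t. Qed.

Lemma opt_state_sqvec t : sqvec P (xo t).
Proof. by apply: sqvecD => //; apply: sqvec_col_mx => //; exact: sqvec0. Qed.

Lemma opt_input_sqvec t : sqvec P (uo t).
Proof.
apply: sqvecB; first exact/sqvecN/sqvec_mul.
by apply: sqvec_col_mx; [exact: sqvec0|exact: sqvec_mul].
Qed.

Lemma intble_stage_cost x u : sqvec P x -> sqvec P u ->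
  intble P (fun om => stage_cost Q R (x om) (u om)).
Proof.
by move=> x2 u2; apply: intbleD; apply: intble_dot => //; exact: sqvec_mul.
Qed.

(** The estimate is a function of [w1] alone. *)
Lemma estimate_residual_uncorrelated p (M : 'M[K]_(p, n1 + n2)) (N : 'M[K]_(p, n2)) t :
  mean P (fun om => dot (M *m xh t om) (N *m xt t om)) = 0.
Proof.
under eq_fun do rewrite dotC.
apply: (@orthogonal_dot _ _ _ _ _ (fun om => N *m xt t om) (fun om => M *m xh t om)).
- exact: sqvec_mul.
- exact: sqvec_mul.
move=> i; apply: orthogonal_to_mul => //; first exact: sqvec_mul.
apply: (residual_orthogonal_noise1 white xt0 xtS (s := t)); last exact: (sqvec_mul M (xh2 t)).
apply: adapted_entry; apply: measurable_mulmx.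
exact: (estimate_adapted_noise1 xh0 xhS).
Qed.

(** The two loops contribute separately, each by its own Lyapunov identity,
and each receives one trace of [J] from its driving noise. *)
Lemma mean_opt_stage_cost t :
  mean P (fun om => stage_cost Q R (xo t om) (uo t om)) =
  J + (a t - a t.+1) + (b t - b t.+1).
Proof.
rewrite /xo /uo; under eq_fun do rewrite (opt_stage_cost psdQ posR solX solY).
have Fx2 := sqvec_mul F1 (xh2 t); have Ft2 := sqvec_mul F2 (xt2 t).
have i1 : intble P (fun om => dot (xh t om) (X *m xh t om)).
  by apply: intble_dot => //; exact: sqvec_mul.
have i2 : intble P (fun om => dot (F1 *m xh t om) (X *m (F1 *m xh t om))).
  by apply: intble_dot => //; exact: sqvec_mul.
have i3 : intble P (fun om => dot (xt t om) (Y *m xt t om)).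
  by apply: intble_dot => //; exact: sqvec_mul.
have i4 : intble P (fun om => dot (F2 *m xt t om) (Y *m (F2 *m xt t om))).
  by apply: intble_dot => //; exact: sqvec_mul.
have c2 p (M : 'M[K]_(p, n2)) q : sqvec P (fun om => col_mx (0 : 'cV_q) (M *m xt t om)).
  by apply: sqvec_col_mx; [exact: sqvec0|exact: sqvec_mul].
have i5 : intble P (fun om => dot (Q *m xh t om) (col_mx 0 (xt t om))).
  by apply: intble_dot; [exact: sqvec_mul|have := c2 _ 1%:M n1; under eq_fun do rewrite mul1mx].
have i6 : intble P (fun om => dot (R *m (L1 *m xh t om)) (col_mx 0 (L2 *m xt t om))).
  by apply: intble_dot => //; apply: sqvec_mul; exact: sqvec_mul.
have z5 : mean P (fun om => dot (Q *m xh t om) (col_mx 0 (xt t om))) = 0.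
  have := estimate_residual_uncorrelated Q (col_mx 0 1%:M) t.
  by under eq_fun do rewrite mul_col_mx mul0mx mul1mx.
have z6 : mean P (fun om => dot (R *m (L1 *m xh t om)) (col_mx 0 (L2 *m xt t om))) = 0.
  have := estimate_residual_uncorrelated (R *m L1) (col_mx 0 L2) t.
  by under eq_fun do rewrite mul_col_mx mul0mx -mulmxA.
rewrite meanD; [|by apply: intbleD; exact: intbleB|by apply/intbleZ/intbleD].
rewrite meanD; [|exact: intbleB|exact: intbleB].
rewrite meanB// meanB// (meanZ _ (intbleD i5 i6)) (meanD i5 i6) z5 z6 addr0 mulr0 addr0.
rewrite /a /b (mean_estimate_step white xh0 xhS t symX) (mean_residual_step white xt0 xtS t symY).
by rewrite /J; ring.
Qed.

Lemma mean_opt_cost N :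
  mean P (fun om => \sum_(t < N) stage_cost Q R (xo t om) (uo t om)) =
  N%:R * J - a N - b N.
Proof.
rewrite mean_sum => [|t]; last first.
  by apply: intble_stage_cost; [exact: opt_state_sqvec|exact: opt_input_sqvec].
elim: N => [|N IH].
  rewrite big_ord0 mul0r /a /b.
  under [X in _ = _ - mean P X - _]eq_fun do rewrite xh0 dot0l.
  under [X in _ = _ - mean P X]eq_fun do rewrite xt0 dot0l.
  by rewrite mean_cst !subr0.
rewrite big_ord_recr/= IH mean_opt_stage_cost -natr1.
by ring.
Qed.

Lemma opt_value_bounded : exists c, forall N, a N + b N <= c.
Proof.
have [c hc] := quad_bounded X xh2 (estimate_bounded white xh0 xhS stabX).
have [c' hc'] := quad_bounded Y xt2 (residual_bounded white xt0 xtS stabY).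
by exists (c + c') => N; exact: lerD (hc N) (hc' N).
Qed.

Lemma costate_bounded :
  exists c, forall N, mean P (fun om => sqnorm (costate X Y (xh N om) (xt N om))) <= c.
Proof.
have [c hc] := quad_bounded (X^T *m X) xh2 (estimate_bounded white xh0 xhS stabX).
have [c' hc'] := quad_bounded (Y^T *m Y) xt2 (residual_bounded white xt0 xtS stabY).
exists (2 * (c + c')) => N.
have i1 : intble P (fun om => dot (xh N om) (X^T *m X *m xh N om)).
  by apply: intble_dot => //; exact: sqvec_mul.
have i2 : intble P (fun om => dot (xt N om) (Y^T *m Y *m xt N om)).
  by apply: intble_dot => //; exact: sqvec_mul.
apply: (@le_trans _ _ (2 * (mean P (fun om => dot (xh N om) (X^T *m X *m xh N om)) +
  mean P (fun om => dot (xt N om) (Y^T *m Y *m xt N om))))); last first.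
  by rewrite ler_wpM2l//; exact: lerD (hc N) (hc' N).
rewrite -meanD// -meanZ; last exact: intbleD.
apply: le_mean.
- apply: intble_sqnorm; apply: sqvecD; first exact: sqvec_mul.
  by apply: sqvec_col_mx; [exact: sqvec0|exact: sqvec_mul].
- exact/intbleZ/intbleD.
- move=> om; apply: (le_trans (sqnormD _ _)); rewrite ler_wpM2l//.
  rewrite -!dotvv dot_col_mx dot0l add0r -!mulmxA.
  by rewrite (dotMr X^T) (dotMr Y^T) !trmxK.
Qed.

Section comparison.
Variables (x : nat -> T -> 'cV[K]_(n1 + n2)) (u : nat -> T -> 'cV[K]_(m1 + m2)).
Hypothesis sys : system A B (fun t => w t) x u.

Let dx t om := x t om - xo t om.
Let du t om := u t om - uo t om.

Lemma deviation0 om : dx 0%N om = 0.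
Proof.
have [x0 _] := sys om.
by rewrite /dx /xo /opt_state x0 xh0 xt0 col_mx0 addr0 subr0.
Qed.

Lemma deviationS t om : dx t.+1 om = A *m dx t om + B *m du t om.
Proof.
have [_ xS] := sys om.
have xoS : xo t.+1 om = A *m xo t om + B *m uo t om + w t om.
  rewrite /xo /uo /A /B (opt_system A11 A21 A22 B1 B2 R X Y) /opt_state xhS xtS.
  rewrite -[w t om in RHS]vsubmxK -/F1 -/F2 -addrA -[RHS]addrA; congr (_ + _).
  by rewrite !add_col_mx addr0 !add0r.
rewrite /dx xS xoS /du !mulmxBr.
by rewrite opprD addrACA subrr addr0 opprD addrACA.
Qed.

Let incr t om := costate X Y (col_mx (usubmx (w t om)) 0) (dsubmx (w t om)).
(** The part of the first variation that has mean zero: the costate increment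
due to the noise at time [t], paired with a state that does not know this
noise, and the residual paired with functions of [w1]. *)
Let noise_pairing t om := dot (incr t om) (dx t.+1 om)
  + (dot (cross_state A21 A22 B2 Q R Y *m xt t om) (usubmx (dx t om))
  + dot (cross_input A22 B2 R Y *m xt t om) (usubmx (du t om))).

Lemma first_variation N om :
  \sum_(t < N) (dot (Q *m xo t om) (dx t om) + dot (R *m uo t om) (du t om)) =
  \sum_(t < N) noise_pairing t om
  - dot (costate X Y (xh N om) (xt N om)) (dx N om).
Proof.
elim: N => [|N IH]; first by rewrite !big_ord0 deviation0 dot0r subr0.
rewrite !big_ord_recr/= IH /xo /uo (costate_step posR solX solY) -/F1 -/F2.
rewrite -deviationS /noise_pairing.
have -> : costate X Y (xh N.+1 om) (xt N.+1 om) =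
    costate X Y (F1 *m xh N om) (F2 *m xt N om) + incr N om.
  rewrite /incr /costate xhS xtS !mulmxDr addrACA; congr (_ + _).
  by rewrite add_col_mx addr0.
move: (costate X Y (xh N om) _) (costate X Y (F1 *m _) _) (incr N om) => p q r.
by rewrite dotDl; ring.
Qed.

Lemma cost_expansion N om :
  \sum_(t < N) stage_cost Q R (x t om) (u t om) =
  \sum_(t < N) stage_cost Q R (xo t om) (uo t om) +
  (\sum_(t < N) stage_cost Q R (dx t om) (du t om)
   - 2 * dot (costate X Y (xh N om) (xt N om)) (dx N om)) +
  2 * \sum_(t < N) noise_pairing t om.
Proof.
have -> : \sum_(t < N) stage_cost Q R (x t om) (u t om) =
    \sum_(t < N) stage_cost Q R (xo t om) (uo t om) +
    \sum_(t < N) stage_cost Q R (dx t om) (du t om) +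
    2 * \sum_(t < N) (dot (Q *m xo t om) (dx t om) + dot (R *m uo t om) (du t om)).
  rewrite mulr_sumr -!big_split; apply: eq_bigr => t _ /=.
  rewrite -stage_costD; [|exact: psd_sym|exact: posdef_sym].
  by rewrite /dx /du !subrKC.
by rewrite first_variation; ring.
Qed.

Hypothesis info : information_constraint x u.

(** Since [A] and [B] are block triangular and block diagonal, the first
subsystem is closed under the information constraint: [x1] and [u1] depend on
[w1] only, however nonlinear the feedback laws are. *)
Lemma admissible_adapted t :
  [/\ adapted wf t (x t), adapted w1 t (fun om => usubmx (x t om)),
      adapted wf t (u t) & adapted w1 t (fun om => usubmx (u t om))].
Proof.
have mtuple k (z : nat -> T -> 'cV[K]_k) p r (y : nat -> T -> 'cV[K]_p) :
    (forall s, (s <= r)%N -> adapted z s (y s)) ->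
    adapted z r (fun om => [tuple y s om | s < r.+1]).
  move=> ay; apply/measurable_fun_tnthP => i.
  rewrite (_ : _ \o _ = y i); last by apply/funext => om /=; rewrite tnth_mktuple.
  by apply: adapted_le (ay i _); rewrite -ltnS.
have input r : (forall s, (s <= r)%N -> adapted wf s (x s)) ->
    (forall s, (s <= r)%N -> adapted w1 s (fun om => usubmx (x s om))) ->
    adapted wf r (u r) /\ adapted w1 r (fun om => usubmx (u r om)).
  move=> ax ax1; have [[f mf fE] [g mg gE]] := info r.
  have a1 : adapted w1 r (fun om => usubmx (u r om)).
    under eq_fun do rewrite fE.
    exact: (measurableT_comp mf (mtuple _ _ _ _ (fun s om => usubmx (x s om)) ax1)).
  split=> //.
  have -> : u r = fun om => col_mx (usubmx (u r om)) (dsubmx (u r om)).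
    by apply/funext => om; rewrite vsubmxK.
  apply: measurable_col_mx; first exact: noise1_adapted_sub.
  under eq_fun do rewrite gE.
  exact: (measurableT_comp mg (mtuple _ _ _ _ x ax)).
have state r : forall s, (s <= r)%N ->
    adapted wf s (x s) /\ adapted w1 s (fun om => usubmx (x s om)).
  elim: r => [|r IH] s.
    rewrite leqn0 => /eqP ->.
    have -> : x 0%N = fun=> 0 by apply/funext => om; have [] := sys om.
    by split; exact: measurable_cst.
  rewrite leq_eqVlt => /orP[/eqP ->|]; last by rewrite ltnS => /IH.
  have [au au1] := input r (fun q h => (IH q h).1) (fun q h => (IH q h).2).
  have [ax ax1] := IH r (leqnn r).
  have xS : x r.+1 = fun om => A *m x r om + B *m u r om + w r om.
    by apply/funext => om; have [] := sys om.
  rewrite xS; split.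
    apply: measurable_mxD; last exact: (@adapted_past _ _ _ _ wf r.+1 r).
    apply: measurable_mxD; apply: measurable_mulmx.
      exact: adapted_le ax.
    exact: adapted_le au.
  rewrite (_ : (fun om => _) = fun om => A11 *m usubmx (x r om)
      + B1 *m usubmx (u r om) + w1 r om); last first.
    apply/funext => om; rewrite /A /B /w1 /=.
    rewrite -{1}[x r om]vsubmxK -{1}[u r om]vsubmxK !mul_block_col !mul0mx !addr0.
    by rewrite -{1}[w r om]vsubmxK !add_col_mx col_mxKu.
  apply: measurable_mxD; last exact: (@adapted_past _ _ _ _ w1 r.+1 r).
  apply: measurable_mxD; apply: measurable_mulmx.
    exact: adapted_le ax1.
  exact: adapted_le au1.
have [ax ax1] := state t t (leqnn t).
have [au au1] := input t (fun q h => (state t q h).1) (fun q h => (state t q h).2).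
by split.
Qed.

Lemma admissible_sqvec N : (forall t, (t < N)%N -> sqvec P (u t)) ->
  forall t, (t <= N)%N -> sqvec P (x t).
Proof.
move=> u2; elim=> [_|t IH tN].
  have -> : x 0%N = fun=> 0 by apply/funext => om; have [] := sys om.
  exact: sqvec0.
have -> : x t.+1 = fun om => A *m x t om + B *m u t om + w t om.
  by apply/funext => om; have [] := sys om.
apply: sqvecD; last exact: noise_sqvec white t.
apply: sqvecD; apply: sqvec_mul; first exact/IH/ltnW.
exact: u2.
Qed.

(** Orthogonality of the noise to the past, applied to the next deviation
[dx(t+1) = A dx(t) + B du(t)], and of the residual to the functions of [w1],
applied to the first blocks of [dx(t)] and [du(t)]. *)
Lemma noise_pairing_mean N t : (t < N)%N -> (forall s, (s < N)%N -> sqvec P (u s)) ->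
  intble P (noise_pairing t) /\ mean P (noise_pairing t) = 0.
Proof.
move=> tN u2.
have x2 := admissible_sqvec u2.
have dx2 s : (s <= N)%N -> sqvec P (dx s).
  by move=> sN; apply: sqvecB; [exact: x2|exact: opt_state_sqvec].
have du2 s : (s < N)%N -> sqvec P (du s).
  by move=> sN; apply: sqvecB; [exact: u2|exact: opt_input_sqvec].
have incr2 : sqvec P (incr t).
  apply: sqvecD; first by apply: sqvec_mul; exact: noise1_sqvec white t.
  by apply: sqvec_col_mx; [exact: sqvec0|apply: sqvec_mul; exact: noise2_sqvec white t].
have [ax ax1 au au1] := admissible_adapted t.
have axh1 : adapted w1 t (xh t) by exact: (estimate_adapted_noise1 xh0 xhS).
have axh : adapted wf t (xh t) by exact: (estimate_adapted xh0 xhS).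
have axt : adapted wf t (xt t) by exact: (residual_adapted xt0 xtS).
have i1 : intble P (fun om => dot (incr t om) (dx t.+1 om)).
  by apply: intble_dot => //; exact: dx2.
have dxu2 : sqvec P (fun om => usubmx (dx t om)) by apply/sqvec_usubmx/dx2/ltnW.
have duu2 : sqvec P (fun om => usubmx (du t om)) by exact/sqvec_usubmx/du2.
have xtM2 p (M : 'M[K]_(p, n2)) : sqvec P (fun om => M *m xt t om) by exact: sqvec_mul.
have i2 := intble_dot (xtM2 _ (cross_state A21 A22 B2 Q R Y)) dxu2.
have i3 := intble_dot (xtM2 _ (cross_input A22 B2 R Y)) duu2.
split; first by apply: intbleD => //; exact: intbleD.
rewrite meanD//; last exact: intbleD.
rewrite meanD//.
have adx1 : adapted w1 t (fun om => usubmx (dx t om)).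
  rewrite (_ : (fun om => _) = fun om => usubmx (x t om) + (-1)%:M *m usubmx (xh t om)).
    apply: measurable_mxD => //; apply: measurable_mulmx.
    exact: measurable_usubmx.
  apply/funext => om; rewrite /dx /xo /opt_state linearB linearD /= col_mxKu addr0.
  by rewrite mul_scalar_mx scaleN1r.
have adu1 : adapted w1 t (fun om => usubmx (du t om)).
  rewrite (_ : (fun om => _) = fun om => usubmx (u t om) + usubmx (L1 *m xh t om)).
    apply: measurable_mxD => //; apply: measurable_usubmx.
    exact: measurable_mulmx.
  apply/funext => om; rewrite /du /uo /opt_input opprB addrCA opprK -/L1 linearD linearD /=.
  by rewrite col_mxKu add0r addrC.
have -> : mean P (fun om => dot (cross_state A21 A22 B2 Q R Y *m xt t om)
    (usubmx (dx t om))) = 0.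
  apply: (@orthogonal_dot _ _ _ _ _ (fun om => _ *m xt t om)) => // i.
  apply: orthogonal_to_mul => //.
  apply: (residual_orthogonal_noise1 white xt0 xtS (s := t)); last exact: dxu2.
  exact: adapted_entry.
have -> : mean P (fun om => dot (cross_input A22 B2 R Y *m xt t om)
    (usubmx (du t om))) = 0.
  apply: (@orthogonal_dot _ _ _ _ _ (fun om => _ *m xt t om)) => // i.
  apply: orthogonal_to_mul => //.
  apply: (residual_orthogonal_noise1 white xt0 xtS (s := t)); last exact: duu2.
  exact: adapted_entry.
have axo : adapted wf t (xo t).
  by apply: measurable_mxD => //; apply: measurable_col_mx.
have auo : adapted wf t (uo t).
  rewrite (_ : uo t = fun om => (- L1) *m xh t om + col_mx 0 ((- L2) *m xt t om)).
    apply: measurable_mxD; first exact: measurable_mulmx.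
    by apply: measurable_col_mx => //; exact: measurable_mulmx.
  by apply/funext => om; rewrite /uo /opt_input !mulNmx opp_col_mx oppr0.
have adx : adapted wf t (dx t.+1).
  rewrite (_ : dx t.+1 = fun om => (A *m x t om + (- A) *m xo t om)
      + (B *m u t om + (- B) *m uo t om)).
    apply: measurable_mxD; apply: measurable_mxD; apply: measurable_mulmx;
    [exact: ax|exact: axo|exact: au|exact: auo].
  apply/funext => om; rewrite deviationS /dx /du.
  by move: (xo t om) (uo t om) => p q; rewrite !mulmxBr !mulNmx.
rewrite (_ : mean P _ = 0) ?addr0// ?add0r//.
apply: orthogonal_dot => //; first exact: dx2.
move=> i; have phi2 := dx2 t.+1 tN i.
have aphi := adapted_entry i adx.
apply: orthogonal_toD => //.
- by apply: sqvec_mul; exact: noise1_sqvec white t.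
- by apply: sqvec_col_mx; [exact: sqvec0|apply: sqvec_mul; exact: noise2_sqvec white t].
- apply: orthogonal_to_mul => //; first exact: noise1_sqvec white t.
  exact: (noise1_orthogonal_past white aphi phi2).
- apply: orthogonal_to_col_mx; first exact: orthogonal_to0.
  apply: orthogonal_to_mul => //; first exact: noise2_sqvec white t.
  exact: (noise2_orthogonal_past white aphi phi2).
Qed.

End comparison.

End optimal_process.

Fixpoint noise_driven n (F : 'M[K]_n) (g : nat -> T -> 'cV[K]_n) t om : 'cV[K]_n :=
  if t is t'.+1 then F *m noise_driven F g t' om + g t' om else 0.

(** Only controllers with square integrable inputs are treated here; for the
others the cost is infinite.  The constant comes from the comparison trajectory
and from detectability, not from the controller. *)
Lemma cost_lower_bound : detectable Q A -> exists k, forall x u N,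
  system A B (fun t => w t) x u -> information_constraint x u ->
  (forall t, (t < N)%N -> sqvec P (u t)) ->
  N%:R * J - k <= mean P (fun om => \sum_(t < N) stage_cost Q R (x t om) (u t om)).
Proof.
move=> detQ.
(* the proposed closed loop, driven by the same noise as the competitor *)
pose xh := noise_driven F1 (fun t om => col_mx (usubmx (w t om)) 0).
pose xt := noise_driven F2 (fun t om => dsubmx (w t om)).
have xh0 om : xh 0%N om = 0 by [].
have xt0 om : xt 0%N om = 0 by [].
have xhS t om : xh t.+1 om = F1 *m xh t om + col_mx (usubmx (w t om)) 0 by [].
have xtS t om : xt t.+1 om = F2 *m xt t om + dsubmx (w t om) by [].
have [c c_gt0 term] := detectable_terminal_bound B psdQ posR detQ.
have [c1 opt_bound] := opt_value_bounded xh0 xt0 xhS xtS.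
have [c2 cost_bound] := costate_bounded xh0 xt0 xhS xtS.
exists (c1 + c * c2) => x u N sys info u2.
pose xo t om := opt_state (xh t om) (xt t om).
pose uo t om := opt_input A11 A21 A22 B1 B2 R X Y (xh t om) (xt t om).
pose dx t om := x t om - xo t om; pose du t om := u t om - uo t om.
pose p om := costate X Y (xh N om) (xt N om).
have xo2 t : sqvec P (xo t) by exact: opt_state_sqvec.
have uo2 t : sqvec P (uo t) by exact: opt_input_sqvec.
have x2 := admissible_sqvec sys u2.
have p2 : sqvec P p.
  apply: sqvecD; first by apply: sqvec_mul; exact: estimate_sqvec white _ _ xh0 xhS N.
  apply: sqvec_col_mx; first exact: sqvec0.
  by apply: sqvec_mul; exact: residual_sqvec white _ _ xt0 xtS N.
have dx2 t : (t <= N)%N -> sqvec P (dx t).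
  by move=> tN; apply: sqvecB => //; exact: x2.
have du2 t : (t < N)%N -> sqvec P (du t).
  by move=> tN; apply: sqvecB => //; exact: u2.
under eq_fun do rewrite (cost_expansion xh0 xt0 xhS xtS sys).
have i1 : intble P (fun om => \sum_(t < N) stage_cost Q R (xo t om) (uo t om)).
  by apply: intble_sum => t _; exact: intble_stage_cost.
have i2 : intble P (fun om => \sum_(t < N) stage_cost Q R (dx t om) (du t om)).
  apply: intble_sum => t _; apply: intble_stage_cost; first exact/dx2/ltnW.
  exact: du2.
have i3 : intble P (fun om => 2 * dot (p om) (dx N om)).
  by apply/intbleZ/intble_dot => //; exact: dx2.
have i4 (t : 'I_N) := noise_pairing_mean xh0 xt0 xhS xtS sys info (ltn_ord t) u2.
have i5 := intble_sum (index_enum 'I_N) (p := xpredT) (fun t _ => (i4 t).1).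
rewrite meanD; [|by apply: intbleD => //; exact: intbleB|exact: intbleZ].
rewrite meanD//; last exact: intbleB.
rewrite (mean_opt_cost xh0 xt0 xhS xtS) meanZ//.
rewrite [X in 2 * X](mean_sum _ (fun t => (i4 t).1)).
rewrite [X in 2 * X]big1 ?mulr0 ?addr0; last by move=> t _; exact: (i4 t).2.
have : - (c * c2) <= mean P (fun om => \sum_(t < N) stage_cost Q R (dx t om) (du t om)
    - 2 * dot (p om) (dx N om)).
  apply: (@le_trans _ _ (mean P (fun om => (- c) * sqnorm (p om)))).
    rewrite meanZ; last exact: intble_sqnorm.
    by rewrite mulNr lerN2 ler_pM2l//; exact: cost_bound.
  apply: le_mean; [exact/intbleZ/intble_sqnorm|exact: intbleB|move=> om].
  rewrite mulNr (le_trans (dot_young (p om) (dx N om) c_gt0))// lerD2r.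
  rewrite ler_pdivrMl//; apply: (term (dx^~ om) (du^~ om)).
    by have := deviation0 xh0 xt0 sys om.
  by move=> t; exact: (deviationS xhS xtS sys).
have := opt_bound N.
set e1 := mean P _; set e2 := mean P _; set e3 := mean P _.
lra.
Qed.

Lemma average_costE x u N : average_cost P Q R x u N =
  ((N%:R^-1)%:E * \int[P]_om (\sum_(t < N) stage_cost Q R (x t om) (u t om))%:E)%E.
Proof.
rewrite /average_cost unlock; congr (_ * _)%E; apply: eq_integral => om _.
by congr EFin; apply: eq_bigr => t _; rewrite stage_costE.
Qed.

(** If the cost is finite, positive definiteness of [R] makes all the inputs
square integrable. *)
Lemma average_cost_lower_bound : detectable Q A ->
  exists k, forall x u, system A B (fun t => w t) x u ->
  information_constraint x u ->
  forall N, ((J - k * N.+1%:R^-1)%:E <= average_cost P Q R x u N.+1)%E.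
Proof.
move=> detQ; have [k bound] := cost_lower_bound detQ.
exists k => x u sys info N; rewrite average_costE.
have N0 : 0 < N.+1%:R^-1 :> K by rewrite invr_gt0.
have ax t : measurable_fun setT (x t).
  have [a _ _ _] := admissible_adapted sys info t.
  exact: (adapted_measurable (fun r => noise_measurable w r) a).
have au t : measurable_fun setT (u t).
  have [_ _ a _] := admissible_adapted sys info t.
  exact: (adapted_measurable (fun r => noise_measurable w r) a).
have mdot p (f g : T -> 'cV[K]_p) : measurable_fun setT f -> measurable_fun setT g ->
    measurable_fun setT (fun om => dot (f om) (g om)).
  move=> mf mg; under eq_fun do rewrite dotE.
  by apply: measurable_sum => i; apply: measurable_funM; exact: measurable_mx_coord.
pose S om := \sum_(t < N.+1) stage_cost Q R (x t om) (u t om).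
have mS : measurable_fun setT S.
  apply: measurable_sum => t; apply: measurable_funD; apply: mdot => //;
  exact: measurable_mulmx.
have stage0 t om : 0 <= stage_cost Q R (x t om) (u t om).
  by apply: stage_cost_ge0 => //; exact: posdef_psd.
have S0 om : 0 <= S om by apply: sumr_ge0.
have [Soo|Sfin] := eqVneq (\int[P]_om (S om)%:E)%E +oo%E.
  by rewrite -/(S _) Soo gt0_muley ?leey.
have Si : intble P S.
  apply/integrableP; split; first exact/measurable_EFinP.
  under eq_integral do rewrite /= ger0_norm//.
  by rewrite ltey.
have [cR cR0 uR] := posdef_sqnorm posR.
have u2 t : (t < N.+1)%N -> sqvec P (u t).
  move=> tN; apply: (sqvec_sqnorm_le (c := fun om => cR * S om)) => //.
    exact: intbleZ.
  move=> om; apply: (le_trans (uR _)); rewrite ler_wpM2l//.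
  rewrite /S (bigD1 (Ordinal tN))//= /stage_cost addrAC lerDr.
  by rewrite addr_ge0 ?psd_ge0// sumr_ge0// => s _; exact: stage0.
rewrite (mean_fin Si) -EFinM lee_fin ler_pdivlMl// mulrBr mulrCA.
by rewrite divff ?mulr1 ?pnatr_eq0//; exact: bound.
Qed.

Lemma limn_einf_lower_bound : detectable Q A -> forall x u,
  system A B (fun t => w t) x u -> information_constraint x u ->
  (J%:E <= limn_einf (average_cost P Q R x u))%E.
Proof.
move=> /average_cost_lower_bound[k bound] x u sys info.
rewrite limn_einf_lim; apply/lee_addgt0Pr => e e0; rewrite -leeBlDr//.
apply: lime_ge; first exact: is_cvg_einfs.
have small : \forall n \near \oo, k * n.+1%:R^-1 <= e.
  have : k * n.+1%:R^-1 @[n --> \oo] --> k * 0.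
    by apply: cvgM; [exact: cvg_cst|exact: cvg_harmonic].
  rewrite mulr0 => /cvgrPdist_le/(_ e e0); apply: filterS => n.
  by rewrite sub0r normrN; apply: le_trans; exact: ler_norm.
have [N _ smallN] := small.
exists N.+1 => // n /= Nn; apply: le_ereal_inf_tmp => _ [p /= np <-].
case: p np => [|p] np; first by have := leq_trans Nn np.
apply: le_trans (bound x u sys info p); rewrite -EFinB lee_fin lerD2l lerN2.
by apply: smallN; rewrite /= -ltnS (leq_trans Nn).
Qed.

Section optimal_controller.
Variables (x : nat -> T -> 'cV[K]_(n1 + n2)) (u : nat -> T -> 'cV[K]_(m1 + m2)).
Variable eta : nat -> T -> 'cV[K]_n2.
Let L11 := ulsubmx L1.
Let L12 := ursubmx L1.
Let L21 := dlsubmx L1.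
Let L22 := drsubmx L1.
Hypothesis sys : system A B (fun t => w t) x u.
Hypothesis eta0 : forall om, eta 0%N om = 0.
Hypothesis etaS : forall t om, eta t.+1 om =
  (A22 - B2 *m L22) *m eta t om + row_mx (A21 - B2 *m L21) 0 *m x t om.
Hypothesis uE : forall t om, u t om =
  - (col_mx L12 (L22 - L2) *m eta t om) - block_mx L11 0 L21 L2 *m x t om.

Let xh t om := col_mx (usubmx (x t om)) (eta t om).
Let xt t om := dsubmx (x t om) - eta t om.

Lemma controller_state t om : x t om = opt_state (xh t om) (xt t om).
Proof.
by rewrite /opt_state add_col_mx addr0 addrC subrK vsubmxK.
Qed.

Lemma controller_input t om :
  u t om = opt_input A11 A21 A22 B1 B2 R X Y (xh t om) (xt t om).
Proof.
rewrite uE /opt_input -/L1 -/L2 /xh /xt -[x t om in LHS]vsubmxK.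
rewrite -[L1 in RHS]submxK mul_col_mx !mul_block_col mul0mx addr0.
rewrite !opp_col_mx !add_col_mx oppr0 addr0 -/L11 -/L12 -/L21 -/L22.
congr col_mx; first by rewrite -opprD addrC.
rewrite mulmxBl mulmxBr !opprD !opprK.
set p := L22 *m _; set q := L21 *m _; set r := L2 *m eta t om; set s := L2 *m _.
by rewrite [- p + r]addrC -addrA [- p + _]addrA [- p - q]addrC -!addrA addrC -!addrA.
Qed.

Lemma controller_estimate0 om : xh 0%N om = 0.
Proof. by have [x0 _] := sys om; rewrite /xh x0 eta0 linear0 col_mx0. Qed.

Lemma controller_residual0 om : xt 0%N om = 0.
Proof. by have [x0 _] := sys om; rewrite /xt x0 eta0 linear0 subr0. Qed.

Lemma controller_stateS t om : x t.+1 om =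
  opt_state (F1 *m xh t om) (F2 *m xt t om) + w t om.
Proof.
have [_ ->] := sys om; congr (_ + _).
by rewrite controller_state controller_input; exact: opt_system.
Qed.

Lemma controller_etaS t om : eta t.+1 om = dsubmx (F1 *m xh t om).
Proof.
rewrite etaS /F1 /xh /A /B -{1}[L1]submxK mulmx_block !mul0mx.
rewrite opp_block_mx add_block_mx mul_block_col col_mxKd.
rewrite -[x t om in LHS]vsubmxK mul_row_col mul0mx !addr0 !add0r.
by rewrite addrC.
Qed.

Lemma controller_estimateS t om :
  xh t.+1 om = F1 *m xh t om + col_mx (usubmx (w t om)) 0.
Proof.
rewrite {1}/xh controller_etaS controller_stateS /opt_state.
move: (F1 *m xh t om) => z; rewrite -[z in RHS]vsubmxK add_col_mx addr0.
by rewrite !linearD /= col_mxKu addr0.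
Qed.

Lemma controller_residualS t om : xt t.+1 om = F2 *m xt t om + dsubmx (w t om).
Proof.
rewrite {1}/xt controller_etaS controller_stateS /opt_state.
rewrite !linearD /= col_mxKd.
by rewrite addrAC (addrC (dsubmx _)) addrK.
Qed.

Lemma controller_average_cost : average_cost P Q R x u @ \oo --> J%:E.
Proof.
have xh0 := controller_estimate0; have xt0 := controller_residual0.
have xhS := controller_estimateS; have xtS := controller_residualS.
have [c value_le] := opt_value_bounded xh0 xt0 xhS xtS.
pose v N := mean P (fun om => dot (xh N om) (X *m xh N om)) +
            mean P (fun om => dot (xt N om) (Y *m xt N om)).
have v0 N : 0 <= v N.
  by rewrite addr_ge0// mean_ge0// => om; apply: psd_ge0; [have [] := solX|have [] := solY].
have costE N : average_cost P Q R x u N.+1 = (J - v N.+1 * N.+1%:R^-1)%:E.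
  rewrite average_costE.
  have E : (fun om => \sum_(t < N.+1) stage_cost Q R (x t om) (u t om)) =
      (fun om => \sum_(t < N.+1) stage_cost Q R (opt_state (xh t om) (xt t om))
         (opt_input A11 A21 A22 B1 B2 R X Y (xh t om) (xt t om))).
    apply/funext => om; apply: eq_bigr => t _.
    by rewrite controller_state controller_input.
  under eq_integral do rewrite (congr1 (fun f => f _) E).
  rewrite mean_fin; last first.
    apply: intble_sum => t _; apply: intble_stage_cost.
      exact: (opt_state_sqvec xh0 xt0 xhS xtS).
    exact: (opt_input_sqvec xh0 xt0 xhS xtS).
  rewrite (mean_opt_cost xh0 xt0 xhS xtS) -EFinM; congr EFin.
  by rewrite -addrA -opprD mulrBr mulKf ?pnatr_eq0// [in RHS]mulrC.
rewrite -cvg_shiftS/=.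
under eq_cvg do rewrite costE.
apply: cvg_EFin; first exact: nearW.
rewrite -[X in _ --> X]subr0; apply: cvgB; first exact: cvg_cst.
apply: (@squeeze_cvgr _ _ _ _ (fun=> 0) (fun N => c * N.+1%:R^-1)).
- apply: nearW => N; rewrite mulr_ge0//=.
  by rewrite ler_wpM2r//; exact: value_le.
- exact: cvg_cst.
- rewrite -[X in _ --> X](mulr0 c).
  by apply: cvgM; [exact: cvg_cst|exact: cvg_harmonic].
Qed.

(** The estimate [eta(t)] as a function of the observed history, as required
to exhibit the feedback laws. *)
Fixpoint estimator t (z : nat -> 'cV[K]_n1) : 'cV[K]_n2 :=
  if t is s.+1
  then (A22 - B2 *m L22) *m estimator s z + (A21 - B2 *m L21) *m z s else 0.

Lemma estimator_eq t z z' : (forall s, (s < t)%N -> z s = z' s) ->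
  estimator t z = estimator t z'.
Proof.
elim: t => [//|t IH] zz /=; rewrite zz// IH// => s st.
by apply: zz; exact: ltnW.
Qed.

Lemma controller_estimator t om :
  eta t om = estimator t (fun s => usubmx (x s om)).
Proof.
elim: t => [|t IH]; first exact: eta0.
by rewrite etaS IH -{1}[x t om]vsubmxK mul_row_col mul0mx addr0.
Qed.

Lemma estimator_measurable d' (S : measurableType d') (z : nat -> S -> 'cV[K]_n1) t :
  (forall s, measurable_fun setT (z s)) ->
  measurable_fun setT (fun om => estimator t (z^~ om)).
Proof.
move=> mz; elim: t => [|t IH] /=; first exact: measurable_cst.
by apply: measurable_mxD; exact: measurable_mulmx.
Qed.

Lemma controller_information : information_constraint x u.
Proof.
move=> t; have tuple_entry k (y : nat -> T -> 'cV[K]_k) om s : (s <= t)%N ->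
    tnth [tuple y s om | s < t.+1] (inord s) = y s om.
  by move=> st; rewrite tnth_mktuple inordK.
split.
  exists (fun p : t.+1.-tuple 'cV[K]_n1 =>
      (- L12) *m estimator t (fun s => tnth p (inord s))
      + (- L11) *m tnth p (inord t)).
    apply: measurable_mxD; apply: measurable_mulmx.
      by apply: estimator_measurable => s; exact: measurable_tnth.
    exact: measurable_tnth.
  move=> om; rewrite (tuple_entry _ (fun s om => usubmx (x s om)))//.
  rewrite (@estimator_eq _ _ (fun s => usubmx (x s om))) => [|s st]; last first.
    by rewrite (tuple_entry _ (fun s om => usubmx (x s om)))// ltnW.
  rewrite -controller_estimator uE -[x t om in LHS]vsubmxK mul_col_mx mul_block_col.
  by rewrite mul0mx addr0 !opp_col_mx add_col_mx col_mxKu !mulNmx.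
exists (fun p : t.+1.-tuple 'cV[K]_(n1 + n2) =>
    (- (L22 - L2)) *m estimator t (fun s => usubmx (tnth p (inord s)))
    + ((- L21) *m usubmx (tnth p (inord t)) + (- L2) *m dsubmx (tnth p (inord t)))).
  apply: measurable_mxD; last apply: measurable_mxD; apply: measurable_mulmx.
  - apply: estimator_measurable => s; apply: measurable_usubmx.
    exact: measurable_tnth.
  - by apply: measurable_usubmx; exact: measurable_tnth.
  - by apply: measurable_dsubmx; exact: measurable_tnth.
move=> om; rewrite tuple_entry//.
rewrite (@estimator_eq _ _ (fun s => usubmx (x s om))) => [|s st]; last first.
  by rewrite tuple_entry// ltnW.
rewrite -controller_estimator uE -[x t om in LHS]vsubmxK mul_col_mx mul_block_col.
rewrite !opp_col_mx add_col_mx col_mxKd opprD.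
by move: (L22 - L2) => M; rewrite !mulNmx.
Qed.

End optimal_controller.

End two_player.

Theorem theorem1 (K : realType) (n1 n2 m1 m2 : nat)
    (A11 : 'M[K]_n1) (A21 : 'M[K]_(n2, n1)) (A22 : 'M[K]_n2)
    (B1 : 'M[K]_(n1, m1)) (B2 : 'M[K]_(n2, m2))
    (W1 : 'M[K]_n1) (W2 : 'M[K]_n2)
    (Q : 'M[K]_(n1 + n2)) (R : 'M[K]_(m1 + m2))
    (X : 'M[K]_(n1 + n2)) (Y : 'M[K]_n2)
    (d : measure_display) (T : measurableType d) (P : probability T K)
    (w : nat -> {RV P >-> 'cV[K]_(n1 + n2)}) :
  let A : 'M[K]_(n1 + n2) := block_mx A11 0 A21 A22 in
  let B : 'M[K]_(n1 + n2, m1 + m2) := block_mx B1 0 0 B2 in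
  let Q22 := drsubmx Q in
  let R22 := drsubmx R in
  let L1 := riccati_gain A B R X in
  let L2 := riccati_gain A22 B2 R22 Y in
  let L11 := ulsubmx L1 in
  let L12 := ursubmx L1 in
  let L21 := dlsubmx L1 in
  let L22 := drsubmx L1 in
  let J := \tr (ulsubmx X *m W1) + \tr (Y *m W2) in
  gaussian_white_noise (block_mx W1 0 0 W2) w ->
  psd Q -> posdef R ->
  stabilizable A B -> stabilizable A22 B2 ->
  detectable Q A -> detectable Q22 A22 ->
  stabilizing_riccati_solution A B Q R X ->
  stabilizing_riccati_solution A22 B2 Q22 R22 Y ->
  (forall (x : nat -> T -> 'cV[K]_(n1 + n2)) (u : nat -> T -> 'cV[K]_(m1 + m2))
          (eta : nat -> T -> 'cV[K]_n2),
     system A B w x u ->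
     (forall om, eta 0%N om = 0) ->
     (forall t om, eta t.+1 om =
        (A22 - B2 *m L22) *m eta t om + row_mx (A21 - B2 *m L21) 0 *m x t om) ->
     (forall t om, u t om =
        - (col_mx L12 (L22 - L2) *m eta t om)
        - block_mx L11 0 L21 L2 *m x t om) ->
     information_constraint x u /\
     average_cost P Q R x u @ \oo --> J%:E) /\
  (forall (x : nat -> T -> 'cV[K]_(n1 + n2)) (u : nat -> T -> 'cV[K]_(m1 + m2)),
     system A B w x u -> information_constraint x u ->
     (J%:E <= limn_einf (average_cost P Q R x u))%E).
Proof.
move=> A B Q22 R22 L1 L2 L11 L12 L21 L22 J white psdQ posR _ _ detQ _ solX solY.
split=> [x u eta sys eta0 etaS uE|x u sys info].
  split; first exact: (controller_information eta0 etaS uE).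
  exact: (controller_average_cost white psdQ posR solX solY sys eta0 etaS uE).
exact: (limn_einf_lower_bound white psdQ posR solX solY detQ sys info).
Qed.
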